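(* Let $f:U\to\mathbb{H}$ be a slice regular function which is a finite map. Put $$C_0(f)=\{q\in U : Df_q \text{ is singular}\},\qquad C(f)=f(C_0(f)),\qquad S(f)=f^{-1}(C(f)).$$ Then the restriction $$f|_{U\setminus S(f)}:U\setminus S(f)\to f(U\setminus S(f))\subseteq\mathbb{H}\setminus C(f)$$ is a covering map.
   Context: $\mathbb{H}$ is the algebra of quaternions and $\mathbb{S}=\{I\in\mathbb{H}: I^2=-1\}$. For $z\in\mathbb{C}$, $I\in\mathbb{S}$ put $\pi(z,I)=\mathrm{Re}(z)+I\,\mathrm{Im}(z)\in\mathbb{H}$. Elements of the real tensor product $\mathbb{C}\otimes\mathbb{H}$ are written $w=w_0+\sqrt{-1}\,w_1$ with $w_0,w_1\in\mathbb{H}$; put $\overline{w}=w_0-\sqrt{-1}\,w_1$ and $\pi(w,I)=w_0+Iw_1$. The complex structure on $\mathbb{C}\otimes\mathbb{H}\cong\mathbb{C}^4$ is multiplication by $\sqrt{-1}$. Let $\mathcal{U}\subset\mathbb{C}$ be an open set with $\overline{\mathcal{U}}=\mathcal{U}$ (invariant under complex conjugation; it need not be connected) and $U=\pi(\mathcal{U}\times\mathbb{S})\subset\mathbb{H}$. A stem function is a map $F:\mathcal{U}\to\mathbb{C}\otimes\mathbb{H}$ with $F(\overline z)=\overline{F(z)}$; it induces the slice function $f=\mathcal{I}(F):U\to\mathbb{H}$ defined by $f(\pi(z,I))=\pi(F(z),I)$. If $F$ is holomorphic, $f$ is called slice regular. $Df_q$ denotes the real differential of $f$ at $q$, a real linear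 endomorphism of $\mathbb{H}\cong\mathbb{R}^4$; singular means not invertible. A finite map is a continuous closed map with finite fibres (equivalently, a proper map with finite fibres). *)

(* Defs.v *)
From mathcomp Require Import all_boot all_order all_algebra.
From mathcomp Require Import all_classical all_reals topology normedtype derive.
From mathcomp Require Import complex.

Set Implicit Arguments.
Unset Strict Implicit.
Unset Printing Implicit Defensive.
Import Order.TTheory GRing.Theory Num.Theory.
Import numFieldNormedType.Exports.

Local Open Scope ring_scope.
Local Open Scope classical_set_scope.
Local Open Scope complex_scope.

(* Row vectors hold the coordinates in the basis 1, i, j, k.  The norm on them
   is the sup norm, which induces the usual topology of R^4. *)
Definition quat (R : realType) : normedModType R := 'rV[R]_4.

Definition mkquat (R : realType) (a b c d : R) : quat R :=
  \row_(n < 4) [:: a; b; c; d]`_n.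

Definition quat_real (R : realType) (a : R) : quat R := mkquat a 0 0 0.

Definition qmul (R : realType) (p q : quat R) : quat R :=
  let x (n : nat) : R := p 0 (inord n) in
  let y (n : nat) : R := q 0 (inord n) in
  let x0 := x 0%N in let x1 := x 1%N in let x2 := x 2%N in let x3 := x 3%N in
  let y0 := y 0%N in let y1 := y 1%N in let y2 := y 2%N in let y3 := y 3%N in
  mkquat (x0 * y0 - x1 * y1 - x2 * y2 - x3 * y3)
         (x0 * y1 + x1 * y0 + x2 * y3 - x3 * y2)
         (x0 * y2 - x1 * y3 + x2 * y0 + x3 * y1)
         (x0 * y3 + x1 * y2 - x2 * y1 + x3 * y0).

Definition imag_units (R : realType) : set (quat R) :=
  [set I | qmul I I = - quat_real 1].

(* C (x) H, identified with C^4 through the real basis 1, i, j, k of H; its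
   complex structure is the scalar multiplication of the C-module C^4. *)
Definition cquat (R : realType) : normedModType R[i] := 'rV[R[i]]_4.

(* w = w_0 + sqrt(-1) w_1 with w_0 = cq_re w and w_1 = cq_im w *)
Definition cq_re (R : realType) (w : cquat R) : quat R :=
  map_mx (fun z : R[i] => complex.Re z) w.

Definition cq_im (R : realType) (w : cquat R) : quat R :=
  map_mx (fun z : R[i] => complex.Im z) w.

Definition cq_conj (R : realType) (w : cquat R) : cquat R :=
  map_mx (fun z : R[i] => z^*) w.

Definition pi_C (R : realType) (z : R[i]) (I : quat R) : quat R :=
  quat_real (complex.Re z) + complex.Im z *: I.

Definition pi_CH (R : realType) (w : cquat R) (I : quat R) : quat R :=
  cq_re w + qmul I (cq_im w).

Definition slice_domain (R : realType) (D : set R[i]) : set (quat R) :=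
  [set q | exists z I, [/\ D z, imag_units I & q = pi_C z I]].

(* Maps are total functions; only the values of F on D and of f on
   slice_domain D are ever constrained. *)
Definition stem_function (R : realType) (D : set R[i])
    (F : R[i] -> cquat R) : Prop :=
  forall z, D z -> F z^* = cq_conj (F z).

Definition induces (R : realType) (D : set R[i]) (F : R[i] -> cquat R)
    (f : quat R -> quat R) : Prop :=
  forall z I, D z -> imag_units I -> f (pi_C z I) = pi_CH (F z) I.

(* Differentiability is over the field R[i]: the differential is C-linear. *)
Definition holomorphic_on (R : realType) (D : set R[i])
    (F : R[i] -> cquat R) : Prop :=
  forall z, D z -> differentiable (F : R[i]^o -> cquat R) (z : R[i]^o).

Definition slice_regular (R : realType) (D : set R[i])
    (f : quat R -> quat R) : Prop :=
  exists F : R[i] -> cquat R,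
    [/\ stem_function D F, holomorphic_on D F & induces D F f].

(* f restricted to A, as a map from the subspace A to Y *)
Definition finite_map (X Y : topologicalType) (A : set X) (f : X -> Y) : Prop :=
  [/\ {within A, continuous f},
      forall K : set X, K `<=` A -> closed (K : set (subspace A)) ->
        closed (f @` K)
    & forall y, finite_set (A `&` f @^-1` [set y])].

Definition homeomorphism_on (X Y : topologicalType) (W : set X) (V : set Y)
    (p : X -> Y) : Prop :=
  [/\ set_fun W V p, {within W, continuous p} &
      exists g : Y -> X,
        [/\ set_fun V W g, {within V, continuous g},
            forall x, W x -> g (p x) = x & forall y, V y -> p (g y) = y]].

(* V is an open subset of B, evenly covered by p restricted to A *)
Definition evenly_covered (X Y : topologicalType) (A : set X) (B : set Y)
    (p : X -> Y) (V : set Y) : Prop :=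
  [/\ V `<=` B, open (V : set (subspace B)) &
      exists sheets : set (set X),
        [/\ A `&` p @^-1` V = \bigcup_(W in sheets) W,
            trivIset sheets id,
            forall W, sheets W -> open (W : set (subspace A))
          & forall W, sheets W -> homeomorphism_on W V p]].

(* p restricted to A is a covering map from the subspace A onto the subspace B *)
Definition covering_map (X Y : topologicalType) (A : set X) (B : set Y)
    (p : X -> Y) : Prop :=
  [/\ p @` A = B, {within A, continuous p} &
      forall y, B y -> exists2 V, V y & evenly_covered A B p V].

Definition crit_points (R : realType) (U : set (quat R))
    (f : quat R -> quat R) : set (quat R) :=
  [set q | U q /\ ~ bijective ('d f q)].

Definition crit_values (R : realType) (U : set (quat R))
    (f : quat R -> quat R) : set (quat R) :=
  f @` crit_points U f.

Definition crit_fibres (R : realType) (U : set (quat R))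
    (f : quat R -> quat R) : set (quat R) :=
  U `&` f @^-1` crit_values U f.

(* Main.v *)
Require Import Defs.
From HB Require Import structures.
From mathcomp Require Import all_boot all_order all_algebra.
From mathcomp Require Import all_classical all_reals topology normedtype derive.
From mathcomp Require Import interval_inference sequences ereal measure.
From mathcomp Require Import lebesgue_measure lebesgue_integral.
From mathcomp Require Import complex ring lra.

(** The theorem holds because f is strictly differentiable at every point q
    of U: f x - f y is a fixed linear map of x - y up to an error e |x - y|
    when x and y are both close to q.  Granting this, let the differential at
    q be invertible.  The contraction principle makes f injective and open
    near q, and the lower Lipschitz bound |x - y| <= C |f x - f y| keeps
    critical points away (strict_diff_sheet).  Over a value y outside C(f) the
    fibre is a finite set of such points q_1, ..., q_n; choose disjoint
    neighbourhoods W_i of them on which f is injective and open.  As f is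
    closed, f (U minus the union of the W_i) is a closed set without y, and
    removing it from the intersection of the f (W_i) leaves an open V whose
    whole preimage lies in the W_i, hence is free of critical points and is
    cut into the sheets of V by the W_i (covering_of_sheets).

    Strict differentiability of f comes from that of the stem function F,
    through f q = F_0 + (v / |v|) F_1 at Re q + i |v|, where v is the
    imaginary part of q and F = F_0 + sqrt(-1) F_1.  Off the real axis this is
    a composition of strictly differentiable functions.  At a real point
    v / |v| is singular, but F_1 vanishes on the real axis: subtracting from
    F_1 its linear part k |v|, which contributes the linear term k v, leaves a
    function G that is e-Lipschitz near the point and satisfies |G| <= e |v|,
    and then (v / |v|) G is Lipschitz with a constant of order e
    (strict_diff1_stem_Im).

    For F, which is only assumed to be complex differentiable at each point,
    strictness amounts to the continuity of F', that is, to Cauchy's theory.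
    It is developed for rectangles: the integral over the boundary vanishes
    by Goursat's bisection (goursat), the contour can be moved across regions
    where the integrand is differentiable (rectint_deform), and this gives
    n F(w) as the integral of F(z) / (z - w), where n is a nonzero constant.
    Then F(w) - F(w') is w - w' times an integral that depends continuously
    on (w, w') (cdiff_on_strict). *)

Set Implicit Arguments.
Unset Strict Implicit.
Unset Printing Implicit Defensive.
Import Order.TTheory GRing.Theory Num.Theory.
Import numFieldNormedType.Exports.
Import Normc.

Local Open Scope ring_scope.
Local Open Scope classical_set_scope.
Local Open Scope complex_scope.

Local Notation Re := complex.Re.
Local Notation Im := complex.Im.

(** * The modulus of a complex number *)

Section ComplexModulus.
Variable R : realType.
Implicit Types (z w : R[i]) (x : R).

Lemma complex_eq z w : Re z = Re w -> Im z = Im w -> z = w.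
Proof. by case: z w => [a b] [c d] /= -> ->. Qed.

Lemma ReD z w : Re (z + w) = Re z + Re w. Proof. by case: z w => [? ?] []. Qed.
Lemma ImD z w : Im (z + w) = Im z + Im w. Proof. by case: z w => [? ?] []. Qed.
Lemma ReN z : Re (- z) = - Re z. Proof. by case: z. Qed.
Lemma ImN z : Im (- z) = - Im z. Proof. by case: z. Qed.
Lemma ReM z w : Re (z * w) = Re z * Re w - Im z * Im w.
Proof. by case: z w => [? ?] []. Qed.
Lemma ImM z w : Im (z * w) = Re z * Im w + Im z * Re w.
Proof. by case: z w => [? ?] []. Qed.

Lemma normc_ge0 z : 0 <= normc z.
Proof. by case: z => a b; exact: sqrtr_ge0. Qed.

Lemma ler_norm_Re z : `|Re z| <= normc z.
Proof.
case: z => a b /=; rewrite -sqrtr_sqr; apply: ler_wsqrtr.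
by rewrite lerDl sqr_ge0.
Qed.

Lemma ler_norm_Im z : `|Im z| <= normc z.
Proof.
case: z => a b /=; rewrite -sqrtr_sqr; apply: ler_wsqrtr.
by rewrite lerDr sqr_ge0.
Qed.

Lemma ler_normc_ReIm z : normc z <= `|Re z| + `|Im z|.
Proof.
case: z => a b /=.
rewrite -[leRHS]ger0_norm ?addr_ge0// -sqrtr_sqr; apply: ler_wsqrtr.
rewrite sqrrD !real_normK ?num_real// -addrA lerD2l lerDr.
by rewrite mulrn_wge0// mulr_ge0.
Qed.

Lemma normc_distC z w : normc (z - w) = normc (w - z).
Proof. by rewrite -normcN opprB. Qed.

Lemma ler_normc_sub z w : normc z - normc w <= normc (z - w).
Proof. by rewrite lerBlDr; apply: le_trans (le_normcD _ _); rewrite subrK. Qed.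

Lemma normc_gt0 z : z != 0 -> 0 < normc z.
Proof.
by rewrite lt_def normc_ge0 andbT; apply: contra_neq => /eq0_normc.
Qed.

Lemma normc_real x : normc x%:C = `|x|.
Proof. by rewrite /= expr0n addr0 sqrtr_sqr. Qed.

Lemma normci : normc ('i : R[i]) = 1.
Proof. by rewrite /= expr0n/= add0r expr1n sqrtr1. Qed.
End ComplexModulus.

(** * Integrals of complex-valued functions over segments *)

Section SegmentIntegral.
Variable R : realType.
Notation mu := (@lebesgue_measure R).
Implicit Types (g h : R -> R[i]) (a b m M : R) (k : R[i]).

Definition seg_integrable a b g :=
  mu.-integrable `[a, b] (EFin \o (fun x => Re (g x))) /\
  mu.-integrable `[a, b] (EFin \o (fun x => Im (g x))).

Definition segint a b g : R[i] :=
  (\int[mu]_(x in `[a, b]) Re (g x)) +i* (\int[mu]_(x in `[a, b]) Im (g x)).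

Lemma segintD a b g h : seg_integrable a b g -> seg_integrable a b h ->
  segint a b (fun x => g x + h x) = segint a b g + segint a b h.
Proof.
move=> [g1 g2] [h1 h2]; apply: complex_eq; rewrite /segint ?ReD ?ImD /=.
- by rewrite -RintegralD//; apply: eq_Rintegral => x _; rewrite ReD.
- by rewrite -RintegralD//; apply: eq_Rintegral => x _; rewrite ImD.
Qed.

Lemma seg_integrableD a b g h : seg_integrable a b g -> seg_integrable a b h ->
  seg_integrable a b (fun x => g x + h x).
Proof.
move=> [g1 g2] [h1 h2]; split.
- have := @integrableD _ _ _ mu _ (measurable_itv `[a, b]%R) _ _ g1 h1.
  by apply: eq_integrable => // x _ /=; rewrite ReD EFinD.
- have := @integrableD _ _ _ mu _ (measurable_itv `[a, b]%R) _ _ g2 h2.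
  by apply: eq_integrable => // x _ /=; rewrite ImD EFinD.
Qed.

Lemma integrable_seg_scale a b r (f : R -> R) :
  mu.-integrable `[a, b] (EFin \o f) ->
  mu.-integrable `[a, b] (EFin \o (fun x => r * f x)).
Proof.
move=> /(@integrableZl _ _ _ mu _ (measurable_itv `[a, b]%R) r).
by apply: eq_integrable.
Qed.

Lemma seg_integrableZ a b g k : seg_integrable a b g ->
  seg_integrable a b (fun x => k * g x).
Proof.
move=> [g1 g2]; split.
- have := @integrableB _ _ _ mu _ (measurable_itv `[a, b]%R) _ _
    (integrable_seg_scale (Re k) g1) (integrable_seg_scale (Im k) g2).
  by apply: eq_integrable => // x _ /=; rewrite ReM EFinB.
- have := @integrableD _ _ _ mu _ (measurable_itv `[a, b]%R) _ _
    (integrable_seg_scale (Re k) g2) (integrable_seg_scale (Im k) g1).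
  by apply: eq_integrable => // x _ /=; rewrite ImM EFinD.
Qed.

Lemma segintZ a b g k : seg_integrable a b g ->
  segint a b (fun x => k * g x) = k * segint a b g.
Proof.
move=> [g1 g2]; have Z := integrable_seg_scale.
apply: complex_eq; rewrite ?ReM ?ImM/=.
- rewrite -!RintegralZl// -RintegralB//; [|exact: Z|exact: Z].
  by apply: eq_Rintegral => x _; rewrite ReM.
- rewrite -!RintegralZl// -RintegralD//; [|exact: Z|exact: Z].
  by apply: eq_Rintegral => x _; rewrite ImM.
Qed.

Lemma seg_integrableB a b g h : seg_integrable a b g -> seg_integrable a b h ->
  seg_integrable a b (fun x => g x - h x).
Proof.
move=> ig ih.
have := seg_integrableD ig (seg_integrableZ (-1) ih).
by under eq_fun do rewrite mulN1r.
Qed.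

Lemma eq_segint a b g h : (forall x, a <= x <= b -> g x = h x) ->
  segint a b g = segint a b h.
Proof.
by move=> gh; apply: complex_eq => /=; apply: eq_Rintegral => x;
  rewrite inE/= in_itv/= => /gh ->.
Qed.

Lemma segint_split a m b g : a <= m -> m <= b -> seg_integrable a b g ->
  segint a b g = segint a m g + segint m b g.
Proof.
move=> am mb [g1 g2].
have S f : mu.-integrable `[a, b] (EFin \o f) ->
    \int[mu]_(x in `[a, b]) f x =
    \int[mu]_(x in `[a, m]) f x + \int[mu]_(x in `[m, b]) f x.
  move=> fi.
  have := Rintegral_itvB (x := m) fi; rewrite !bnd_simp => /(_ am mb).
  rewrite Rintegral_itv_obnd_cbnd; last first.
    apply: integrableS fi => //; apply: subset_itv; rewrite bnd_simp//.
  by move=> <-; rewrite addrC subrK.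
by apply: complex_eq; rewrite ?ReD ?ImD /= S.
Qed.

Lemma lebesgue_measure_seg a b : a <= b -> fine (mu `[a, b]) = b - a.
Proof.
move=> ab; rewrite lebesgue_measure_itv/= lte_fin.
by move: ab; rewrite le_eqVlt => /predU1P[->|->]; rewrite ?ltxx ?subrr.
Qed.

Lemma Rintegral_seg_cst a b M : a <= b ->
  \int[mu]_(x in `[a, b]) M = (b - a) * M.
Proof. by move=> ab; rewrite Rintegral_cst// lebesgue_measure_seg// mulrC. Qed.

Lemma segint_cst a b k : a <= b -> segint a b (fun=> k) = (b - a)%:C * k.
Proof.
by move=> ab; apply: complex_eq; rewrite ?ReM ?ImM/= Rintegral_seg_cst//; ring.
Qed.

Lemma integrable_seg_cst a b M :
  mu.-integrable `[a, b] (EFin \o (fun=> M)).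
Proof.
apply: continuous_compact_integrable; first exact: segment_compact.
by apply: continuous_subspaceT => x; apply: cvg_cst.
Qed.

Lemma ler_segint_Re a b g M : a <= b -> seg_integrable a b g ->
  (forall x, a <= x <= b -> M <= Re (g x)) -> (b - a) * M <= Re (segint a b g).
Proof.
move=> ab [g1 g2] gM /=; rewrite -Rintegral_seg_cst//.
by apply: le_Rintegral => //; exact: integrable_seg_cst.
Qed.

Lemma ler_segint_Im a b g M : a <= b -> seg_integrable a b g ->
  (forall x, a <= x <= b -> M <= Im (g x)) -> (b - a) * M <= Im (segint a b g).
Proof.
move=> ab [g1 g2] gM /=; rewrite -Rintegral_seg_cst//.
by apply: le_Rintegral => //; exact: integrable_seg_cst.
Qed.

(** The real and imaginary parts are estimated separately, whence the factor 2
    in place of the optimal constant 1. *)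
Lemma ler_normc_segint a b g M : a <= b -> seg_integrable a b g ->
  (forall x, a <= x <= b -> normc (g x) <= M) ->
  normc (segint a b g) <= 2 * ((b - a) * M).
Proof.
move=> ab gi gM; have [g1 g2] := gi.
have B f : mu.-integrable `[a, b] (EFin \o f) ->
    (forall x, a <= x <= b -> `|f x| <= M) ->
    `|\int[mu]_(x in `[a, b]) f x| <= (b - a) * M.
  move=> fi fM; apply: le_trans (le_normr_Rintegral _ fi) _ => //.
  rewrite -Rintegral_seg_cst//; apply: le_Rintegral => //.
  - exact: integrable_norm.
  - exact: integrable_seg_cst.
apply: le_trans (ler_normc_ReIm _) _.
rewrite mulr_natl mulr2n; apply: lerD; apply: B => // x /gM; apply: le_trans.
- exact: ler_norm_Re.
- exact: ler_norm_Im.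
Qed.

End SegmentIntegral.

(** * Complex differentiability relative to a set *)

Section ContinuityOnSets.
Variable R : realType.
Implicit Types (E : set R[i]) (g : R[i] -> R[i]) (z w k : R[i]) (a b : R).

Definition cont_on E g := forall z, E z -> forall e : R, 0 < e ->
  exists2 d : R, 0 < d &
    forall w, E w -> normc (w - z) < d -> normc (g w - g z) < e.

(** Increments stay in E, so that E may be a closed rectangle or a contour. *)
Definition cdiff_on E g := forall z, E z -> exists k, forall e : R, 0 < e ->
  exists2 d : R, 0 < d & forall w, E w -> normc (w - z) < d ->
    normc (g w - g z - k * (w - z)) <= e * normc (w - z).

Lemma cont_onS E E' g : E' `<=` E -> cont_on E g -> cont_on E' g.
Proof.
move=> sub gE z /sub Ez e e0; have [d d0 gd] := gE z Ez e e0.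
by exists d => // w /sub; exact: gd.
Qed.

Lemma cdiff_onS E E' g : E' `<=` E -> cdiff_on E g -> cdiff_on E' g.
Proof.
move=> sub gE z /sub Ez; have [k gk] := gE z Ez; exists k => e e0.
have [d d0 gd] := gk e e0.
by exists d => // w /sub; exact: gd.
Qed.

Lemma cdiff_on_cont E g : cdiff_on E g -> cont_on E g.
Proof.
move=> gE z Ez e e0; have [k gk] := gE z Ez.
have [d d0 gd] := gk 1 ltr01; set M := 1 + normc k.
have M0 : 0 < M by rewrite ltr_wpDr ?normc_ge0.
exists (Num.min d (e / M)); first by rewrite lt_min d0 divr_gt0.
move=> w Ew; rewrite lt_min => /andP[wd we].
rewrite -[g w - g z](subrK (k * (w - z))).
apply: le_lt_trans (le_normcD _ _) _.
apply: le_lt_trans (_ : M * normc (w - z) < e); last first.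
  by rewrite mulrC -ltr_pdivlMr.
by rewrite mulrDl normcM; apply: lerD => //; exact: gd.
Qed.

Lemma cont_on_locally_bounded E g z : cont_on E g -> E z -> exists2 d : R,
  0 < d & forall w, E w -> normc (w - z) < d -> normc (g w) <= normc (g z) + 1.
Proof.
move=> gE Ez; have [d d0 gd] := gE z Ez 1 ltr01; exists d => // w Ew wd.
have := le_normcD (g w - g z) (g z); rewrite subrK => /le_trans; apply.
by rewrite addrC lerD2l ltW// gd.
Qed.

Lemma cdiff_onD E g h : cdiff_on E g -> cdiff_on E h ->
  cdiff_on E (fun z => g z + h z).
Proof.
move=> gE hE z Ez; have [k gk] := gE z Ez; have [l hl] := hE z Ez.
exists (k + l) => e e0; have e20 : 0 < e / 2 by rewrite divr_gt0.
have [d1 d10 gd] := gk _ e20; have [d2 d20 hd] := hl _ e20.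
exists (Num.min d1 d2); first by rewrite lt_min d10.
move=> w Ew; rewrite lt_min => /andP[w1 w2].
have -> : g w + h w - (g z + h z) - (k + l) * (w - z) =
  (g w - g z - k * (w - z)) + (h w - h z - l * (w - z)) by ring.
apply: le_trans (le_normcD _ _) _; rewrite [e]splitr mulrDl.
by apply: lerD; [exact: gd|exact: hd].
Qed.

Lemma cdiff_onM E g h : cdiff_on E g -> cdiff_on E h ->
  cdiff_on E (fun z => g z * h z).
Proof.
move=> gE hE z Ez; have [k gk] := gE z Ez; have [l hl] := hE z Ez.
exists (k * h z + g z * l) => e e0.
have [d3 d30 hb] := cont_on_locally_bounded (cdiff_on_cont hE) Ez.
set M := normc (h z) + 1 + normc (g z) + normc k + 1.
have M0 : 0 < M.
  by rewrite ltr_wpDl// !addr_ge0// ?normc_ge0.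
have e10 : 0 < e / M by rewrite divr_gt0.
have [d1 d10 gd] := gk _ e10; have [d2 d20 hd] := hl _ e10.
have [d4 d40 hc] := cdiff_on_cont hE Ez e10.
exists (Num.min (Num.min d1 d2) (Num.min d3 d4)).
  by rewrite !lt_min d10 d20 d30.
move=> w Ew; rewrite !lt_min => /andP[/andP[w1 w2] /andP[w3 w4]].
have -> : g w * h w - g z * h z - (k * h z + g z * l) * (w - z) =
  (g w - g z - k * (w - z)) * h w + g z * (h w - h z - l * (w - z)) +
  k * (w - z) * (h w - h z) by ring.
apply: le_trans (le_normcD _ _) _; apply: le_trans (lerD (le_normcD _ _) (lexx _)) _.
rewrite !normcM; set n := normc (w - z).
have n0 : 0 <= n by exact: normc_ge0.
have E1 := gd w Ew w1; have E2 := hd w Ew w2; have E3 := hb w Ew w3.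
have E4 := ltW (hc w Ew w4).
apply: le_trans (_ : e / M * n * (normc (h z) + 1) +
  normc (g z) * (e / M * n) + normc k * n * (e / M) <= _).
  apply: lerD; [apply: lerD|].
  - by apply: ler_pM => //; exact: normc_ge0.
  - by apply: ler_wpM2l => //; exact: normc_ge0.
  - by apply: ler_wpM2l => //; rewrite mulr_ge0 ?normc_ge0.
rewrite -[leRHS]/(e * n).
have -> : e * n = e / M * n * M by rewrite mulrAC divfK// gt_eqF.
rewrite /M !mulrDr mulr1.
have := mulr_ge0 (ltW e10) n0; nra.
Qed.

Lemma cdiff_on_cst E k : cdiff_on E (fun=> k).
Proof.
move=> z _; exists 0 => e e0; exists 1 => // w _ _.
by rewrite subrr mul0r subr0 normc0 mulr_ge0 ?normc_ge0 ?ltW.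
Qed.

Lemma cdiff_on_id E : cdiff_on E (fun z => z).
Proof.
move=> z _; exists 1 => e e0; exists 1 => // w _ _.
by rewrite mul1r subrr normc0 mulr_ge0 ?normc_ge0 ?ltW.
Qed.

Lemma cdiff_onV E g : (forall z, E z -> g z != 0) -> cdiff_on E g ->
  cdiff_on E (fun z => (g z)^-1).
Proof.
move=> gn0 gE z Ez; have [k gk] := gE z Ez; have gz0 := gn0 z Ez.
have m0 := normc_gt0 gz0; set m := normc (g z) in m0.
exists (- k / g z ^+ 2) => e e0.
have m2 : 0 < m / 2 by rewrite divr_gt0.
have [d1 d10 gc] := cdiff_on_cont gE Ez m2.
set M := m ^+ 2 / 2 + normc k.
pose e1 := e * m ^+ 3 / 2 / (m + normc k).
have q0 : 0 < m + normc k by rewrite ltr_wpDr ?normc_ge0.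
have e10 : 0 < e1 by rewrite !(divr_gt0, mulr_gt0, exprn_gt0).
have [d2 d20 gd] := gk _ e10.
have [d3 d30 gc'] := cdiff_on_cont gE Ez e10.
exists (Num.min d1 (Num.min d2 d3)); first by rewrite !lt_min d10 d20.
move=> w Ew; rewrite !lt_min => /andP[w1 /andP[w2 w3]].
have gw0 := gn0 w Ew.
have -> : (g w)^-1 - (g z)^-1 - - k / g z ^+ 2 * (w - z) =
   (- g z * (g w - g z - k * (w - z)) + k * (w - z) * (g w - g z)) /
     (g w * g z ^+ 2).
  by field; rewrite gz0.
have mw : m / 2 <= normc (g w).
  have := gc w Ew w1; rewrite normc_distC => /ltW/(le_trans (ler_normc_sub _ _)).
  rewrite -/m; lra.
rewrite normcM normcV !normcM -/m; set n := normc (w - z).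
have n0 : 0 <= n by exact: normc_ge0.
have E1 := gd w Ew w2; have E2 := ltW (gc' w Ew w3).
have A : normc (- g z * (g w - g z - k * (w - z)) + k * (w - z) * (g w - g z))
    <= (m + normc k) * (e1 * n).
  apply: le_trans (le_normcD _ _) _; rewrite !normcM normcN -/m -/n mulrDl.
  apply: lerD; first by rewrite ler_wpM2l// ltW.
  by rewrite -mulrA [n * _]mulrC !ler_wpM2l// ?normc_ge0// ler_wpM2r.
have D : m ^+ 3 / 2 <= normc (g w) * (m * m).
  by rewrite exprSr -mulrA mulrAC mulrC [m * (m / 2)]mulrC; nra.
rewrite ler_pdivrMr; last by rewrite !mulr_gt0// normc_gt0.
apply: le_trans A _.
have -> : (m + normc k) * (e1 * n) = e * n * (m ^+ 3 / 2).
  by rewrite /e1; field; rewrite gt_eqF.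
by rewrite ler_wpM2l// mulr_ge0// ltW.
Qed.

(** The 1-Lipschitz paths include the parametrized sides of rectangles. *)
Lemma seg_integrable_path E g (p : R -> R[i]) a b :
  cont_on E g -> (forall x, a <= x <= b -> E (p x)) ->
  (forall x y, normc (p x - p y) <= `|x - y|) ->
  seg_integrable a b (g \o p).
Proof.
move=> gE pE pL.
have C (h : R[i] -> R) : (forall u v, `|h u - h v| <= normc (u - v)) ->
    lebesgue_measure.-integrable `[a, b] (EFin \o (h \o g \o p)).
  move=> hL; apply: continuous_compact_integrable; first exact: segment_compact.
  apply/subspace_continuousP => x; rewrite /= in_itv/= => xab.
  apply/cvgrPdist_lt => e e0; have [d d0 gd] := gE _ (pE x xab) e e0.
  rewrite near_withinE; apply/nbhs_ballP; exists d => //= y xy.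
  rewrite /= in_itv/= => yab.
  apply: le_lt_trans (hL _ _) _; rewrite normc_distC; apply: gd; first exact: pE.
  by apply: le_lt_trans (pL _ _) _; rewrite distrC.
have CR : forall u v : R[i], `|Re u - Re v| <= normc (u - v).
  by move=> u v; rewrite -ReN -ReD ler_norm_Re.
have CI : forall u v : R[i], `|Im u - Im v| <= normc (u - v).
  by move=> u v; rewrite -ImN -ImD ler_norm_Im.
by split; [exact: (C _ CR)|exact: (C _ CI)].
Qed.

End ContinuityOnSets.

(** * Boundary integrals over rectangles and the theorem of Goursat *)

Section RectangleIntegral.
Variable R : realType.
Implicit Types (E : set R[i]) (g h : R[i] -> R[i]) (z w k l : R[i]).
Implicit Types (a b c d m M e : R).

Definition rect a b c d : set R[i] :=
  [set z | a <= Re z <= b /\ c <= Im z <= d].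

Definition frame a b c d : set R[i] :=
  [set z | rect a b c d z /\ [\/ Re z = a, Re z = b, Im z = c | Im z = d]].

(** The contour integral of g over the positively oriented boundary of the
    rectangle.  Opposite sides are paired, so that the integrands of an affine
    g are constants. *)
Definition rectint a b c d g : R[i] :=
  segint a b (fun x => g (x +i* c) - g (x +i* d)) +
  'i * segint c d (fun y => g (b +i* y) - g (a +i* y)).

Lemma frameS a b c d : frame a b c d `<=` rect a b c d.
Proof. by move=> z []. Qed.

Lemma horizontal_integrable E g a b c : cont_on E g ->
  (forall x, a <= x <= b -> E (x +i* c)) ->
  seg_integrable a b (fun x => g (x +i* c)).
Proof.
move=> gE sub; apply: (seg_integrable_path gE sub) => x y.
apply: le_trans (ler_normc_ReIm _) _.
by rewrite ReD ImD /= subrr normr0 addr0.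
Qed.

Lemma vertical_integrable E g a c d : cont_on E g ->
  (forall y, c <= y <= d -> E (a +i* y)) ->
  seg_integrable c d (fun y => g (a +i* y)).
Proof.
move=> gE sub; apply: (seg_integrable_path gE sub) => x y.
apply: le_trans (ler_normc_ReIm _) _.
by rewrite ReD ImD /= subrr normr0 add0r.
Qed.

Lemma frame_integrable E g a b c d : a <= b -> c <= d ->
  cont_on E g -> frame a b c d `<=` E ->
  [/\ seg_integrable a b (fun x => g (x +i* c)),
      seg_integrable a b (fun x => g (x +i* d)),
      seg_integrable c d (fun y => g (a +i* y)) &
      seg_integrable c d (fun y => g (b +i* y))].
Proof.
move=> ab cd gE sub; split.
- apply: (horizontal_integrable gE) => x xab; apply: sub; split.
    by split=> //=; rewrite lexx.
  by constructor 3.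
- apply: (horizontal_integrable gE) => x xab; apply: sub; split.
    by split=> //=; rewrite lexx cd.
  by constructor 4.
- apply: (vertical_integrable gE) => y ycd; apply: sub; split.
    by split=> //=; rewrite lexx.
  by constructor 1.
- apply: (vertical_integrable gE) => y ycd; apply: sub; split.
    by split=> //=; rewrite lexx ab.
  by constructor 2.
Qed.

Lemma rectint_splitv E g a m b c d : a <= m -> m <= b -> c <= d ->
  cont_on E g -> frame a m c d `<=` E -> frame m b c d `<=` E ->
  rectint a b c d g = rectint a m c d g + rectint m b c d g.
Proof.
move=> am mb cd gE s1 s2.
have [g1 g2 g3 g4] := frame_integrable am cd gE s1.
have [h1 h2 h3 h4] := frame_integrable mb cd gE s2.
have sub : frame a b c d `<=` E.
  move=> z [[/andP[az zb] cz] bz]; case: (leP (Re z) m) => [zm|/ltW mz].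
    case: bz => [za|zb'|zc|zd].
    - by apply: s1; split; [rewrite /rect/= az|constructor 1].
    - apply: s2; split; [|by constructor 2].
      by rewrite /rect/= zb zb' mb.
    - by apply: s1; split; [rewrite /rect/= az|constructor 3].
    - by apply: s1; split; [rewrite /rect/= az|constructor 4].
  case: bz => [za|zb'|zc|zd].
  - by apply: s1; split; [rewrite /rect/= za lexx am|constructor 1].
  - by apply: s2; split; [rewrite /rect/= mz|constructor 2].
  - by apply: s2; split; [rewrite /rect/= mz|constructor 3].
  - by apply: s2; split; [rewrite /rect/= mz|constructor 4].
have [k1 k2 k3 k4] := frame_integrable (le_trans am mb) cd gE sub.
rewrite /rectint (segint_split am mb); last exact: seg_integrableB.
have -> : segint c d (fun y => g (b +i* y) - g (a +i* y)) =
    segint c d (fun y => g (m +i* y) - g (a +i* y)) +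
    segint c d (fun y => g (b +i* y) - g (m +i* y)).
  rewrite -segintD; [|exact: seg_integrableB|exact: seg_integrableB].
  by apply: eq_segint => x _; ring.
by ring.
Qed.

Lemma rectint_splith E g a b c m d : a <= b -> c <= m -> m <= d ->
  cont_on E g -> frame a b c m `<=` E -> frame a b m d `<=` E ->
  rectint a b c d g = rectint a b c m g + rectint a b m d g.
Proof.
move=> ab cm md gE s1 s2.
have [g1 g2 g3 g4] := frame_integrable ab cm gE s1.
have [h1 h2 h3 h4] := frame_integrable ab md gE s2.
have sub : frame a b c d `<=` E.
  move=> z [[az /andP[cz zd]] bz]; case: (leP (Im z) m) => [zm|/ltW mz].
    case: bz => [za|zb'|zc|zd'].
    - by apply: s1; split; [rewrite /rect/= cz|constructor 1].
    - by apply: s1; split; [rewrite /rect/= cz|constructor 2].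
    - by apply: s1; split; [rewrite /rect/= cz|constructor 3].
    - by apply: s2; split; [rewrite /rect/= zd zd' md|constructor 4].
  case: bz => [za|zb'|zc|zd'].
  - by apply: s2; split; [rewrite /rect/= mz|constructor 1].
  - by apply: s2; split; [rewrite /rect/= mz|constructor 2].
  - by apply: s1; split; [rewrite /rect/= zc lexx cm|constructor 3].
  - by apply: s2; split; [rewrite /rect/= mz|constructor 4].
have [k1 k2 k3 k4] := frame_integrable ab (le_trans cm md) gE sub.
rewrite /rectint (segint_split cm md); last exact: seg_integrableB.
have -> : segint a b (fun x => g (x +i* c) - g (x +i* d)) =
    segint a b (fun x => g (x +i* c) - g (x +i* m)) +
    segint a b (fun x => g (x +i* m) - g (x +i* d)).
  rewrite -segintD; [|exact: seg_integrableB|exact: seg_integrableB].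
  by apply: eq_segint => x _; ring.
by ring.
Qed.

Lemma eq_rectint a b c d g h : a <= b -> c <= d ->
  (forall z, frame a b c d z -> g z = h z) ->
  rectint a b c d g = rectint a b c d h.
Proof.
move=> ab cd gh; rewrite /rectint; congr (_ + _ * _); apply: eq_segint => x xab.
- by rewrite !gh//; split; rewrite /rect/= ?lexx ?cd//;
    [constructor 4|constructor 3].
- by rewrite !gh//; split; rewrite /rect/= ?lexx ?ab//;
    [constructor 1|constructor 2].
Qed.

Lemma rectintD E a b c d g h : a <= b -> c <= d -> frame a b c d `<=` E ->
  cont_on E g -> cont_on E h ->
  rectint a b c d (fun z => g z + h z) = rectint a b c d g + rectint a b c d h.
Proof.
move=> ab cd sub gE hE.
have [g1 g2 g3 g4] := frame_integrable ab cd gE sub.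
have [h1 h2 h3 h4] := frame_integrable ab cd hE sub.
rewrite /rectint; set I1 := segint a b _; set I2 := segint c d _.
have -> : I1 = segint a b (fun x => g (x +i* c) - g (x +i* d)) +
               segint a b (fun x => h (x +i* c) - h (x +i* d)).
  rewrite -segintD; [|exact: seg_integrableB|exact: seg_integrableB].
  by apply: eq_segint => x _; ring.
have -> : I2 = segint c d (fun y => g (b +i* y) - g (a +i* y)) +
               segint c d (fun y => h (b +i* y) - h (a +i* y)).
  rewrite -segintD; [|exact: seg_integrableB|exact: seg_integrableB].
  by apply: eq_segint => x _; ring.
by ring.
Qed.

Lemma rectintZ E a b c d g k : a <= b -> c <= d -> frame a b c d `<=` E ->
  cont_on E g ->
  rectint a b c d (fun z => k * g z) = k * rectint a b c d g.
Proof.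
move=> ab cd sub gE.
have [g1 g2 g3 g4] := frame_integrable ab cd gE sub.
rewrite /rectint mulrDr mulrCA.
rewrite -(segintZ k (seg_integrableB g1 g2)) -(segintZ k (seg_integrableB g4 g3)).
by congr (_ + _ * _); apply: eq_segint => x _; ring.
Qed.

Lemma ler_normc_rectint E a b c d g M : a <= b -> c <= d ->
  frame a b c d `<=` E -> cont_on E g ->
  (forall z, frame a b c d z -> normc (g z) <= M) ->
  normc (rectint a b c d g) <= 4 * M * ((b - a) + (d - c)).
Proof.
move=> ab cd sub gE gM.
have [g1 g2 g3 g4] := frame_integrable ab cd gE sub.
rewrite /rectint; apply: le_trans (le_normcD _ _) _.
rewrite normcM normci mul1r mulrDr.
have B u v : normc u <= M -> normc v <= M -> normc (u - v) <= 2 * M.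
  move=> uM vM; apply: le_trans (le_normcD _ _) _.
  by rewrite normcN mulr_natl mulr2n lerD.
apply: lerD.
- have -> : 4 * M * (b - a) = 2 * ((b - a) * (2 * M)) by ring.
  apply: ler_normc_segint => //; first exact: seg_integrableB.
  move=> x xab; apply: B; apply: gM; split; rewrite /rect/= ?lexx ?cd//;
    [by constructor 3|by constructor 4].
- have -> : 4 * M * (d - c) = 2 * ((d - c) * (2 * M)) by ring.
  apply: ler_normc_segint => //; first exact: seg_integrableB.
  move=> x xab; apply: B; apply: gM; split; rewrite /rect/= ?lexx ?ab//;
    [by constructor 2|by constructor 1].
Qed.

Lemma rectint_affine a b c d k l : a <= b -> c <= d ->
  rectint a b c d (fun z => k * z + l) = 0.
Proof.
move=> ab cd; rewrite /rectint.
rewrite (@eq_segint _ a b _ (fun=> k * (0 +i* (c - d)))); last first.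
  move=> x _; rewrite opprD addrACA subrr addr0 -mulrBr; congr (_ * _).
  by apply: complex_eq => /=; rewrite ?subrr.
rewrite (@eq_segint _ c d _ (fun=> k * (b - a)%:C)); last first.
  move=> y _; rewrite opprD addrACA subrr addr0 -mulrBr; congr (_ * _).
  by apply: complex_eq => /=; rewrite ?subrr.
rewrite !segint_cst//.
have -> : 0 +i* (c - d) = 'i * (c - d)%:C :> R[i].
  by apply: complex_eq; rewrite ?ReM ?ImM /=; ring.
rewrite !rmorphB/=; ring.
Qed.

(** The integral is the sum of those over the four quarters, so one quarter
    carries at least a fourth of it. *)
Lemma goursat_step a b c d g : a <= b -> c <= d -> cont_on (rect a b c d) g ->
  exists2 p : R * R,
    [/\ a <= p.1, p.1 + (b - a) / 2 <= b, c <= p.2 & p.2 + (d - c) / 2 <= d] &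
    normc (rectint a b c d g) <=
    4 * normc (rectint p.1 (p.1 + (b - a) / 2) p.2 (p.2 + (d - c) / 2) g).
Proof.
move=> ab cd gE.
pose m := a + (b - a) / 2; pose n := c + (d - c) / 2.
have am : a <= m by rewrite /m; lra.
have mb : m <= b by rewrite /m; lra.
have cn : c <= n by rewrite /n; lra.
have nd : n <= d by rewrite /n; lra.
have sub x1 x2 y1 y2 : a <= x1 -> x2 <= b -> c <= y1 -> y2 <= d ->
    frame x1 x2 y1 y2 `<=` rect a b c d.
  move=> h1 h2 h3 h4 z [[/andP[z1 z2] /andP[z3 z4]] _]; split; apply/andP.
    by split; [exact: le_trans z1|exact: le_trans h2].
  by split; [exact: le_trans z3|exact: le_trans h4].
have mE : m + (b - a) / 2 = b by rewrite /m; lra.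
have nE : n + (d - c) / 2 = d by rewrite /n; lra.
set T := fun p : R * R => rectint p.1 (p.1 + (b - a) / 2) p.2 (p.2 + (d - c) / 2) g.
have E : rectint a b c d g = (T (a, c) + T (a, n)) + (T (m, c) + T (m, n)).
  rewrite /T /= mE nE (rectint_splitv am mb cd gE); [|exact: sub..].
  congr (_ + _).
    by apply: (rectint_splith am cn nd gE); exact: sub.
  by apply: (rectint_splith mb cn nd gE); exact: sub.
apply: contrapT => H.
have lt p : [/\ a <= p.1, p.1 + (b - a) / 2 <= b, c <= p.2 &
    p.2 + (d - c) / 2 <= d] -> 4 * normc (T p) < normc (rectint a b c d g).
  by move=> pv; rewrite ltNge; apply/negP => pT; apply: H; exists p.
have T1 : 4 * normc (T (a, c)) < normc (rectint a b c d g).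
  by apply: lt; split.
have T2 : 4 * normc (T (a, n)) < normc (rectint a b c d g).
  by apply: lt; split; rewrite //= nE.
have T3 : 4 * normc (T (m, c)) < normc (rectint a b c d g).
  by apply: lt; split; rewrite //= mE.
have T4 : 4 * normc (T (m, n)) < normc (rectint a b c d g).
  by apply: lt; split; rewrite //= ?mE ?nE.
have := le_normcD (T (a, c) + T (a, n)) (T (m, c) + T (m, n)).
rewrite -E; have := le_normcD (T (a, c)) (T (a, n)).
have := le_normcD (T (m, c)) (T (m, n)); lra.
Qed.

Lemma nested_segments (u v : nat -> R) :
  (forall n, u n <= u n.+1) -> (forall n, v n.+1 <= v n) ->
  (forall n, u n <= v n) -> exists x, forall n, u n <= x <= v n.
Proof.
move=> uS vS uv.
have uM : {homo u : m n / (m <= n)%N >-> m <= n} by exact: homo_leq (@le_trans _ _) uS.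
have vM : {homo v : m n / (m <= n)%N >-> n <= m}.
  by apply: homo_leq vS => // x y z /[swap]; exact: le_trans.
have uvM (m n : nat) : u m <= v n.
  apply: le_trans (uM _ _ (leq_maxl m n)) _.
  by apply: le_trans (uv _) (vM _ _ (leq_maxr m n)).
have ub (n : nat) : ubound (range u) (v n) by move=> _ [m _ <-].
exists (sup (range u)) => n; apply/andP; split.
  by apply: ub_le_sup; [exists (v n); exact: ub|exists n].
by apply: ge_sup; [exists (u 0%N); exists 0%N|exact: ub].
Qed.

(** Iterated bisection yields rectangles shrinking to a point p, the n-th one
    carrying at least 4^-n of the integral.  Near p the function is affine up
    to o(|z - p|) and the affine part integrates to 0, so that integral is
    also o(4^-n). *)
Lemma goursat a b c d g : a <= b -> c <= d -> cdiff_on (rect a b c d) g ->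
  rectint a b c d g = 0.
Proof.
move=> ab cd gE; have gC := cdiff_on_cont gE.
(* Sides of the n-th rectangle, whose lower left corner will be P n. *)
pose W n := (b - a) / 2 ^+ n; pose H n := (d - c) / 2 ^+ n.
have W0 n : 0 <= W n by rewrite divr_ge0 ?subr_ge0.
have H0 n : 0 <= H n by rewrite divr_ge0 ?subr_ge0.
have WS n : W n / 2 = W n.+1 by rewrite /W exprSr; field.
have HS n : H n / 2 = H n.+1 by rewrite /H exprSr; field.
pose ok n (p : R * R) := [/\ a <= p.1, p.1 + W n <= b, c <= p.2 & p.2 + H n <= d].
pose T n (p : R * R) := normc (rectint p.1 (p.1 + W n) p.2 (p.2 + H n) g).
have sub n p : ok n p ->
    rect p.1 (p.1 + W n) p.2 (p.2 + H n) `<=` rect a b c d.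
  move=> [h1 h2 h3 h4] z [/andP[z1 z2] /andP[z3 z4]]; split; apply/andP.
    by split; [exact: le_trans z1|exact: le_trans h2].
  by split; [exact: le_trans z3|exact: le_trans h4].
have step np : exists q : R * R, ok np.1 np.2 ->
    [/\ np.2.1 <= q.1, q.1 + W np.1.+1 <= np.2.1 + W np.1, np.2.2 <= q.2,
        q.2 + H np.1.+1 <= np.2.2 + H np.1 & T np.1 np.2 <= 4 * T np.1.+1 q].
  case: np => n p /=; have [pv|] := EM (ok n p); last by exists p.
  have [||q] := @goursat_step p.1 (p.1 + W n) p.2 (p.2 + H n) g _ _
    (cont_onS (sub _ _ pv) gC).
  - by rewrite lerDl.
  - by rewrite lerDl.
  - rewrite ![_ + _ - _]addrAC !subrr !add0r WS HS => -[q1 q2 q3 q4] qT.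
    by exists q => _; split.
have [f fP] := choice step.
pose P := fix P n := if n is m.+1 then f (m, P m) else (a, c).
have Pok n : ok n (P n).
  elim: n => [|n IH]; first by rewrite /ok /W /H !expr0 !divr1/= !subrKC.
  have /= [h1 h2 h3 h4 _] := fP (n, P n) IH; have [k1 k2 k3 k4] := IH.
  by split; [exact: le_trans h1|exact: le_trans k2|exact: le_trans h3|exact: le_trans k4].
have PT n : T 0%N (P 0%N) <= 4 ^+ n * T n (P n).
  elim: n => [|n IH]; first by rewrite expr0 mul1r.
  have /= [_ _ _ _ hT] := fP (n, P n) (Pok n).
  apply: le_trans IH _; rewrite exprSr -mulrA ler_wpM2l//.
have [x xP] : exists x, forall n, (P n).1 <= x <= (P n).1 + W n.
  apply: nested_segments => n; try by have /= [] := fP (n, P n) (Pok n).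
  by rewrite lerDl.
have [y yP] : exists y, forall n, (P n).2 <= y <= (P n).2 + H n.
  apply: nested_segments => n; try by have /= [] := fP (n, P n) (Pok n).
  by rewrite lerDl.
set p := x +i* y.
have Ep : rect a b c d p by apply: (sub _ _ (Pok 0%N)); split; [exact: xP|exact: yP].
have [k gk] := gE p Ep.
set S := (b - a) + (d - c).
have S0 : 0 <= S by rewrite addr_ge0 ?subr_ge0.
have T0E : T 0%N (P 0%N) = normc (rectint a b c d g).
  by rewrite /T /W /H !expr0 !divr1/= !subrKC.
have key e : 0 < e -> normc (rectint a b c d g) <= 4 * S ^+ 2 * e.
  move=> e0; have [dl dl0 gd] := gk e e0.
  have [n nS] : exists n, S / dl < 2 ^+ n.
    by exists (Num.bound (S / dl)); exact: upper_nthrootP.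
  have Sn : W n + H n < dl.
    by rewrite /W /H -mulrDl -/S ltr_pdivrMr ?exprn_gt0// mulrC -ltr_pdivrMr.
  set Q := rect (P n).1 ((P n).1 + W n) (P n).2 ((P n).2 + H n).
  have Qp : Q p by split; [exact: xP|exact: yP].
  have QE : Q `<=` rect a b c d by exact: sub.
  have zp z : Q z -> normc (z - p) <= W n + H n.
    move=> [/andP[z1 z2] /andP[z3 z4]]; apply: le_trans (ler_normc_ReIm _) _.
    have /andP[x1 x2] := xP n; have /andP[y1 y2] := yP n.
    by apply: lerD; rewrite ?ReD ?ImD ?ReN ?ImN ler_norml /=; lra.
  have w1 : (P n).1 <= (P n).1 + W n by rewrite lerDl.
  have w2 : (P n).2 <= (P n).2 + H n by rewrite lerDl.
  (* The remainder of the first order expansion of g at p. *)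
  pose r z := g z - g p - k * (z - p).
  have aC : cont_on Q (fun z => - k * z + (k * p - g p)).
    apply: cdiff_on_cont; apply: cdiff_onD; last exact: cdiff_on_cst.
    by apply: cdiff_onM; [exact: cdiff_on_cst|exact: cdiff_on_id].
  have gQ := cont_onS QE gC.
  have rE : r = fun z => g z + (- k * z + (k * p - g p)).
    by apply/funext => z; rewrite /r; ring.
  have rC : cont_on Q r.
    rewrite rE; apply: cdiff_on_cont; apply: cdiff_onD; first exact: cdiff_onS gE.
    apply: cdiff_onD; last exact: cdiff_on_cst.
    by apply: cdiff_onM; [exact: cdiff_on_cst|exact: cdiff_on_id].
  have Tr : rectint (P n).1 ((P n).1 + W n) (P n).2 ((P n).2 + H n) g =
            rectint (P n).1 ((P n).1 + W n) (P n).2 ((P n).2 + H n) r.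
    by rewrite rE (rectintD w1 w2 (@frameS _ _ _ _) gQ aC) rectint_affine// addr0.
  rewrite -T0E; apply: le_trans (PT n) _; rewrite /T Tr.
  apply: le_trans (_ : 4 ^+ n * (4 * (e * (W n + H n)) * (W n + H n)) <= _).
    rewrite ler_wpM2l// ?exprn_ge0//.
    have := @ler_normc_rectint _ _ _ _ _ r (e * (W n + H n)) w1 w2 (@frameS _ _ _ _) rC.
    rewrite ![_ + _ - _]addrAC !subrr !add0r; apply => z [Qz _].
    apply: le_trans (gd z (QE z Qz) _) _; first by apply: le_lt_trans (zp z Qz) _.
    by rewrite ler_wpM2l ?zp// ltW.
  rewrite /W /H -mulrDl -/S.
  have -> : (4 : R) ^+ n = 2 ^+ n * 2 ^+ n by rewrite -exprMn -natrM.
  rewrite le_eqVlt; apply/orP; left; apply/eqP; field; rewrite expf_neq0//.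
apply: eq0_normc; apply: le_anti; rewrite normc_ge0 andbT.
apply/ler_addgt0Pl => e e0; rewrite addr0.
have S1 : 0 < 4 * S ^+ 2 + 1 by rewrite ltr_wpDl// mulr_ge0// exprn_ge0.
apply: le_trans (key (e / (4 * S ^+ 2 + 1)) _) _; first by rewrite divr_gt0.
by rewrite mulrCA ger_pMr// ler_pdivrMr// mul1r lerDl.
Qed.

End RectangleIntegral.

(** * Cauchy formula and strict complex differentiability *)

Section CauchyFormula.
Variable R : realType.
Implicit Types (E : set R[i]) (g h F : R[i] -> R[i]) (z w k l : R[i]).
Implicit Types (a b c d m M e r : R).

Definition open_rect a b c d : set R[i] :=
  [set z | a < Re z < b /\ c < Im z < d].

(** The region between the two rectangles is cut into four rectangles, on each
    of which the theorem of Goursat applies. *)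
Lemma rectint_deform a b c d a' b' c' d' g :
  a <= a' -> a' <= b' -> b' <= b -> c <= c' -> c' <= d' -> d' <= d ->
  cdiff_on (rect a b c d `\` open_rect a' b' c' d') g ->
  rectint a b c d g = rectint a' b' c' d' g.
Proof.
move=> aa ab bb cc cd dd gE; set E := _ `\` _ in gE.
have gC := cdiff_on_cont gE.
have sub x1 x2 y1 y2 : a <= x1 -> x2 <= b -> c <= y1 -> y2 <= d ->
    (x1 <= a' \/ x1 = b') -> (x2 = a' \/ b' <= x2) ->
    (y1 <= c' \/ y1 = d') -> (y2 = c' \/ d' <= y2) ->
    frame x1 x2 y1 y2 `<=` E.
  move=> h1 h2 h3 h4 k1 k2 k3 k4 z [[/andP[z1 z2] /andP[z3 z4]] zb].
  split; first by split; apply/andP; split; lra.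
  move=> [/andP[u1 u2] /andP[u3 u4]].
  case: zb => zb; rewrite zb in u1 u2 u3 u4.
  - by case: k1; lra.
  - by case: k2; lra.
  - by case: k3; lra.
  - by case: k4; lra.
have rsub x1 x2 y1 y2 : a <= x1 -> x2 <= b -> c <= y1 -> y2 <= d ->
    [\/ x2 <= a', b' <= x1, y2 <= c' | d' <= y1] -> rect x1 x2 y1 y2 `<=` E.
  move=> h1 h2 h3 h4 k z [/andP[z1 z2] /andP[z3 z4]].
  split; first by split; apply/andP; split; lra.
  by move=> [/andP[u1 u2] /andP[u3 u4]]; case: k; lra.
have ab' : a' <= b := le_trans ab bb.
have cd' : c' <= d := le_trans cd dd.
have cdd : c <= d := le_trans cc cd'.
rewrite (rectint_splitv aa ab' cdd gC); first last.
- by apply: sub => //; [left|right|left|right].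
- by apply: sub => //; [left|left|left|right].
rewrite goursat//; last by apply: cdiff_onS gE; apply: rsub => //; constructor 1.
rewrite add0r (rectint_splitv ab bb cdd gC); first last.
- by apply: sub => //; [exact: le_trans ab|right|right|left|right].
- by apply: sub => //; [left|right|left|right].
rewrite [X in _ + X]goursat//; last first.
  by apply: cdiff_onS gE; apply: rsub => //; [exact: le_trans ab|constructor 2].
rewrite addr0 (rectint_splith ab cc cd' gC); first last.
- by apply: sub => //; [left|right|left|right].
- by apply: sub => //; [left|right|left|left].
rewrite goursat//; last by apply: cdiff_onS gE; apply: rsub => //; constructor 3.
rewrite add0r (rectint_splith ab cd dd gC); first last.
- by apply: sub => //; [exact: le_trans cd|left|right|right|right].
- by apply: sub => //; [left|right|left|right].
rewrite [X in _ + X]goursat ?addr0//.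
by apply: cdiff_onS gE; apply: rsub => //; [exact: le_trans cd|constructor 4].
Qed.

Lemma cdiff_on_subc E k : cdiff_on E (fun z => z - k).
Proof. by apply: cdiff_onD; [exact: cdiff_on_id|exact: cdiff_on_cst]. Qed.

Lemma cdiff_on_pole E w : ~ E w -> cdiff_on E (fun z => (z - w)^-1).
Proof.
move=> Ew; apply: cdiff_onV; last exact: cdiff_on_subc.
by move=> z Ez; rewrite subr_eq0; apply/eqP => zw; apply: Ew; rewrite -zw.
Qed.

Lemma subr_neq0_sep E z w : E z -> ~ E w -> z - w != 0.
Proof. by move=> Ez Ew; rewrite subr_eq0; apply: contra_notN Ew => /eqP <-. Qed.

Lemma open_rect_frame a b c d w : open_rect a b c d w -> ~ frame a b c d w.
Proof.
move=> [/andP[w1 w2] /andP[w3 w4]] [_ ]; case=> E; move: w1 w2 w3 w4; rewrite E ltxx//.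
Qed.

Lemma eq0_of_le_scale (x : R) (C r0 : R) : 0 < r0 -> 0 <= x ->
  (forall r, 0 < r -> r <= r0 -> x <= C * r) -> x = 0.
Proof.
move=> r00 x0 H; apply: le_anti; rewrite x0 andbT.
apply/ler_addgt0Pl => e e0; rewrite addr0.
have C0 : 0 < `|C| + 1 by rewrite ltr_wpDl.
have [r [r1 r2 r3]] : exists r, [/\ 0 < r, r <= r0 & r <= e / (`|C| + 1)].
  exists (Num.min r0 (e / (`|C| + 1))).
  by rewrite lt_min r00 divr_gt0// !ge_min !lexx orbT.
apply: le_trans (H r r1 r2) _; move: r3; rewrite ler_pdivlMr//.
have := ler_norm C; nra.
Qed.

Lemma open_rect_room a b c d w : open_rect a b c d w -> exists2 r : R, 0 < r &
  forall s, s <= r -> [/\ a <= Re w - s, Re w + s <= b, c <= Im w - s & Im w + s <= d].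
Proof.
move=> [/andP[w1 w2] /andP[w3 w4]].
exists (Num.min (Num.min (Re w - a) (b - Re w)) (Num.min (Im w - c) (d - Im w))).
  by rewrite !lt_min !subr_gt0 w1 w2 w3.
by move=> s; rewrite !le_min => /andP[/andP[s1 s2] /andP[s3 s4]]; split; lra.
Qed.

(** The contour can be shrunk to a square around w; its length tends to 0
    while the difference quotient stays bounded there. *)
Lemma rectint_div_difference a b c d F w : cdiff_on (rect a b c d) F ->
  open_rect a b c d w ->
  rectint a b c d (fun z => (F z - F w) / (z - w)) = 0.
Proof.
move=> FE wo; set h := fun z => _.
have hE E : E `<=` rect a b c d -> ~ E w -> cdiff_on E h.
  move=> sub Ew; apply: cdiff_onM; last exact: cdiff_on_pole.
  apply: cdiff_onD; last exact: cdiff_on_cst.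
  exact: cdiff_onS FE.
have [r0 r00 room] := open_rect_room wo.
have Ew : rect a b c d w.
  by case: wo => /andP[w1 w2] /andP[w3 w4]; split; apply/andP; split; exact: ltW.
have [k Fk] := FE w Ew; have [dl dl0 Fd] := Fk 1 ltr01.
set M := 1 + normc k.
pose r1 := Num.min r0 (dl / 3).
have r10 : 0 < r1 by rewrite lt_min r00 divr_gt0.
apply: eq0_normc; apply: (@eq0_of_le_scale _ (16 * M) r1) => //; first exact: normc_ge0.
move=> r rp; rewrite le_min => /andP[rr0 rdl].
have [h1 h2 h3 h4] := room r rr0.
have wi : open_rect (Re w - r) (Re w + r) (Im w - r) (Im w + r) w.
  by split; apply/andP; split; lra.
rewrite (@rectint_deform _ _ _ _ (Re w - r) (Re w + r) (Im w - r) (Im w + r))//;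
  [|lra|lra|]; last by apply: hE => [z []//|[]].
set E := frame (Re w - r) (Re w + r) (Im w - r) (Im w + r).
have sE : E `<=` rect a b c d.
  move=> z [[/andP[z1 z2] /andP[z3 z4]] _].
  by split; apply/andP; split; lra.
have hC : cont_on E h.
  by apply: cdiff_on_cont; apply: hE => //; exact: open_rect_frame.
have -> : 16 * M * r = 4 * M * (Re w + r - (Re w - r) + (Im w + r - (Im w - r))).
  by ring.
apply: (ler_normc_rectint _ _ _ hC) => //; [lra|lra|].
move=> z Ez; have zw : z - w != 0 by exact: subr_neq0_sep Ez (open_rect_frame wi).
have n0 := normc_gt0 zw.
rewrite /h normcM normcV ler_pdivrMr//.
have zd : normc (z - w) < dl.
  case: Ez => -[/andP[z1 z2] /andP[z3 z4]] _.
  apply: le_lt_trans (ler_normc_ReIm _) _; rewrite ReD ReN ImD ImN.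
  apply: le_lt_trans (_ : r + r < dl); last by lra.
  by apply: lerD; rewrite ler_norml; lra.
rewrite -[F z - F w](subrK (k * (z - w))).
apply: le_trans (le_normcD _ _) _; rewrite mulrDl normcM lerD2r.
by apply: Fd => //; exact: sE.
Qed.

(** The difference of the two integrands has no pole outside the rectangle and
    decays like |z|^-2, so its integral over larger and larger rectangles,
    which does not change, tends to 0. *)
Lemma rectint_pole_cst a b c d w w' :
  open_rect a b c d w -> open_rect a b c d w' ->
  rectint a b c d (fun z => (z - w)^-1) = rectint a b c d (fun z => (z - w')^-1).
Proof.
move=> wo wo'.
have [ab cd] : a <= b /\ c <= d.
  by case: wo => /andP[w1 w2] /andP[w3 w4]; split; lra.
pose g z := (z - w)^-1 - (z - w')^-1.
have gE E : ~ E w -> ~ E w' -> cdiff_on E g.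
  move=> Ew Ew'; apply: cdiff_onD; first exact: cdiff_on_pole.
  have : cdiff_on E (fun z => -1 * (z - w')^-1).
    by apply: cdiff_onM; [exact: cdiff_on_cst|exact: cdiff_on_pole].
  by under eq_fun do rewrite mulN1r.
pose S := (b - a) + (d - c).
have S0 : 0 <= S by rewrite /S; lra.
suff : rectint a b c d g = 0.
  have pC u : open_rect a b c d u ->
      cont_on (frame a b c d) (fun z => (z - u)^-1).
    by move=> uo; apply: cdiff_on_cont; apply: cdiff_on_pole; exact: open_rect_frame.
  have gC : cont_on (frame a b c d) g.
    by apply: cdiff_on_cont; apply: gE; exact: open_rect_frame.
  move=> g0; rewrite -[RHS]addr0 -g0 -(rectintD ab cd _ (pC _ wo') gC)//.
  by apply: eq_rectint => // z _; rewrite /g addrCA subrr addr0.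
apply: eq0_normc.
(* The rectangle is enlarged by M = 1 / r on each side, with r -> 0. *)
apply: (@eq0_of_le_scale _ (4 * normc (w - w') * (S + 4)) 1) => //; first exact: normc_ge0.
move=> r r0 r1; pose M := r^-1.
have M1 : 1 <= M by rewrite /M invf_ge1.
have MS : open_rect a b c d `<=` open_rect (a - M) (b + M) (c - M) (d + M).
  by move=> z [/andP[z1 z2] /andP[z3 z4]]; split; apply/andP; split; lra.
rewrite -(@rectint_deform (a - M) (b + M) (c - M) (d + M)); [|lra..|]; last first.
  by apply: gE => [[]|[]].
set E := frame (a - M) (b + M) (c - M) (d + M).
have gC : cont_on E g.
  by apply: cdiff_on_cont; apply: gE; apply: open_rect_frame; exact: MS.
apply: le_trans (ler_normc_rectint (M := normc (w - w') * r ^+ 2) _ _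
  (@subset_refl _ E) gC _) _; [lra|lra| |].
  have far u z : open_rect a b c d u -> E z -> M <= normc (z - u).
    move=> [/andP[u1 u2] /andP[u3 u4]] [_ zb].
    have := ler_norm_Re (z - u); have := ler_norm_Im (z - u).
    rewrite ReD ReN ImD ImN; move: (normc (z - u)) => n.
    rewrite !ler_norml => /andP[n1 n2] /andP[n3 n4].
    by case: zb => zb; rewrite zb in n1 n2 n3 n4; lra.
  move=> z Ez; have f1 := far w z wo Ez; have f2 := far w' z wo' Ez.
  have p1 : 0 < normc (z - w) by lra.
  have p2 : 0 < normc (z - w') by lra.
  have q1 : z - w != 0 by apply: contraTneq p1 => ->; rewrite normc0 ltxx.
  have q2 : z - w' != 0 by apply: contraTneq p2 => ->; rewrite normc0 ltxx.
  have -> : g z = (w - w') * ((z - w)^-1 * (z - w')^-1).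
    by rewrite /g; field; rewrite q1 q2.
  have i1 : (normc (z - w))^-1 <= r by rewrite -[leRHS]invrK lef_pV2 ?posrE ?invr_gt0.
  have i2 : (normc (z - w'))^-1 <= r by rewrite -[leRHS]invrK lef_pV2 ?posrE ?invr_gt0.
  rewrite !normcM !normcV ler_wpM2l ?normc_ge0// expr2.
  by apply: ler_pM => //; rewrite invr_ge0 normc_ge0.
have -> : b + M - (a - M) + (d + M - (c - M)) = S + 4 * M by rewrite /S; ring.
have rM : r * M = 1 by rewrite /M divff// gt_eqF.
have -> : 4 * (normc (w - w') * r ^+ 2) * (S + 4 * M) =
    4 * normc (w - w') * (S * r ^+ 2 + 4 * r * (r * M)) by ring.
rewrite rM mulr1 -[leRHS]mulrA ler_wpM2l ?mulr_ge0 ?normc_ge0//.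
have : S * r * r <= S * r * 1 by rewrite ler_wpM2l// mulr_ge0// ltW.
nra.
Qed.

(** The integral is 2 pi i; the bound 4, from estimating the integrand on each
    side by its least value, is enough to divide by it. *)
Lemma ler_rectint_pole_center (z0 : R[i]) (r : R) : 0 < r ->
  4 <= Im (rectint (Re z0 - r) (Re z0 + r) (Im z0 - r) (Im z0 + r)
             (fun z => (z - z0)^-1)).
Proof.
move=> r0; set E := frame (Re z0 - r) (Re z0 + r) (Im z0 - r) (Im z0 + r).
have zo : open_rect (Re z0 - r) (Re z0 + r) (Im z0 - r) (Im z0 + r) z0.
  by split; apply/andP; split; lra.
have pC : cont_on E (fun z => (z - z0)^-1).
  by apply: cdiff_on_cont; apply: cdiff_on_pole; exact: open_rect_frame.
have le1 : Re z0 - r <= Re z0 + r by lra.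
have le2 : Im z0 - r <= Im z0 + r by lra.
have [i1 i2 i3 i4] := frame_integrable le1 le2 pC (@subset_refl _ _).
have pole (x y : R) : Im (x +i* y)^-1 = - y / (x ^+ 2 + y ^+ 2).
  by rewrite /= mulNr.
have poleR (x y : R) : Re (x +i* y)^-1 = x / (x ^+ 2 + y ^+ 2) by [].
have est (t : R) : - r <= t -> t <= r -> r^-1 <= r / (t ^+ 2 + r ^+ 2) + r / (t ^+ 2 + r ^+ 2).
  move=> t1 t2; have s0 : 0 < t ^+ 2 + r ^+ 2.
    by rewrite ltr_wpDl ?sqr_ge0// exprn_gt0.
  rewrite -mulrDl ler_pdivlMr// mulrC ler_pdivrMr//.
  have : 0 <= (r - t) * (r + t) by rewrite mulr_ge0//; lra.
  nra.
have len (x : R) : (x + r - (x - r)) * r^-1 = 2.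
  by field; rewrite gt_eqF.
rewrite /rectint ImD ImM /= mul0r mul1r add0r.
have -> : (4 : R) = 2 + 2 by ring.
have shift (x y : R) : (x +i* y) - z0 = (x - Re z0) +i* (y - Im z0) by case: (z0).
apply: lerD.
- rewrite -(len (Re z0)); apply: ler_segint_Im => //; first exact: seg_integrableB.
  move=> x /andP[x1 x2]; rewrite ImD ImN !shift !pole.
  have -> : Im z0 - r - Im z0 = - r by ring.
  have -> : Im z0 + r - Im z0 = r by ring.
  by rewrite sqrrN opprK mulNr opprK; apply: est; lra.
- rewrite -(len (Im z0)); apply: ler_segint_Re => //; first exact: seg_integrableB.
  move=> x /andP[x1 x2]; rewrite ReD ReN !shift !poleR.
  have -> : Re z0 - r - Re z0 = - r by ring.
  have -> : Re z0 + r - Re z0 = r by ring.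
  by rewrite sqrrN mulNr opprK ![r ^+ 2 + _]addrC; apply: est; lra.
Qed.

(** By the Cauchy formula, n (F w - F w') is w - w' times the integral of
    F(z) / ((z - w)(z - w')), and this kernel tends to F(z) / (z - z0)^2
    uniformly on the contour as w and w' tend to z0. *)
Lemma cdiff_on_strict z0 (r0 : R) F : 0 < r0 ->
  cdiff_on (rect (Re z0 - r0) (Re z0 + r0) (Im z0 - r0) (Im z0 + r0)) F ->
  exists K, forall e : R, 0 < e -> exists2 dl : R, 0 < dl & forall w w',
    normc (w - z0) < dl -> normc (w' - z0) < dl ->
    normc (F w - F w' - K * (w - w')) <= e * normc (w - w').
Proof.
move=> r00 FE.
have z0E : rect (Re z0 - r0) (Re z0 + r0) (Im z0 - r0) (Im z0 + r0) z0.
  by split; apply/andP; split; lra.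
have [d0 d00 Fb] := cont_on_locally_bounded (cdiff_on_cont FE) z0E.
set B := normc (F z0) + 1 in Fb; have B0 : 0 < B by rewrite ltr_wpDl ?normc_ge0.
pose r := Num.min r0 (d0 / 3).
have rp : 0 < r by rewrite lt_min r00 divr_gt0.
have [rr0 rd0] : r <= r0 /\ r <= d0 / 3 by rewrite !ge_min !lexx orbT.
set x1 := Re z0 - r; set x2 := Re z0 + r; set y1 := Im z0 - r; set y2 := Im z0 + r.
have x12 : x1 <= x2 by rewrite /x1 /x2; lra.
have y12 : y1 <= y2 by rewrite /y1 /y2; lra.
have sub : rect x1 x2 y1 y2 `<=` rect (Re z0 - r0) (Re z0 + r0) (Im z0 - r0) (Im z0 + r0).
  move=> z [/andP[] + + /andP[] + +]; rewrite /x1 /x2 /y1 /y2 => h1 h2 h3 h4.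
  by split; apply/andP; split; lra.
have FQ := cdiff_onS sub FE.
pose E := frame x1 x2 y1 y2.
have EQ : E `<=` rect x1 x2 y1 y2 by exact: frameS.
have FB z : E z -> normc (F z) <= B.
  move=> /EQ Qz; apply: Fb; first exact: sub.
  case: Qz => -[/andP[] + + /andP[] + +]; rewrite /x1 /x2 /y1 /y2 => h1 h2 h3 h4.
  apply: le_lt_trans (ler_normc_ReIm _) _; rewrite ReD ReN ImD ImN.
  apply: le_lt_trans (_ : r + r < d0); last by lra.
  by apply: lerD; rewrite ler_norml; lra.
have wo w : normc (w - z0) < r -> open_rect x1 x2 y1 y2 w.
  move=> wr; have := ler_norm_Re (w - z0); have := ler_norm_Im (w - z0).
  rewrite ReD ReN ImD ImN !ler_norml => /andP[n1 n2] /andP[n3 n4].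
  by split; apply/andP; rewrite /x1 /x2 /y1 /y2; split; lra.
have z0o : open_rect x1 x2 y1 y2 z0 by apply: wo; rewrite subrr normc0.
pose n := rectint x1 x2 y1 y2 (fun z => (z - z0)^-1).
have n4 : 4 <= normc n.
  apply: le_trans (ler_rectint_pole_center z0 rp) _.
  exact: le_trans (ler_norm _) (ler_norm_Im _).
have n0 : n != 0 by apply: contraTneq n4 => ->; rewrite normc0 -ltNge.
have pole w : open_rect x1 x2 y1 y2 w -> cdiff_on E (fun z => (z - w)^-1).
  by move=> /open_rect_frame; exact: cdiff_on_pole.
have FEc := cdiff_onS EQ FQ.
have cauchy w : open_rect x1 x2 y1 y2 w ->
    n * F w = rectint x1 x2 y1 y2 (fun z => F z / (z - w)).
  move=> wQ; have := rectint_div_difference FQ wQ.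
  rewrite /n (rectint_pole_cst z0o wQ) => h0.
  have hC : cont_on E (fun z => (F z - F w) / (z - w)).
    apply: cdiff_on_cont; apply: cdiff_onM; last exact: pole.
    by apply: cdiff_onD => //; exact: cdiff_on_cst.
  have pC := cdiff_on_cont (pole w wQ).
  have qC : cont_on E (fun z => F w * (z - w)^-1).
    by apply: cdiff_on_cont; apply: cdiff_onM; [exact: cdiff_on_cst|exact: pole].
  rewrite mulrC -(rectintZ _ x12 y12 (@subset_refl _ E) pC) -[LHS]add0r -[X in X + _]h0.
  rewrite -(rectintD x12 y12 (@subset_refl _ E) hC qC).
  by apply: eq_rectint => // z _; rewrite -mulrDl subrK.
pose q z := F z * ((z - z0)^-1 * (z - z0)^-1).
have qC : cdiff_on E q.
  by apply: cdiff_onM => //; apply: cdiff_onM; exact: pole.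
pose K := n^-1 * rectint x1 x2 y1 y2 q.
exists K => e e0.
(* Within dl of z0 the kernels differ by at most 6 dl B / r^3 on the contour,
   whose length is estimated by 16 r; this must be at most 4 e. *)
pose dl := Num.min (r / 2) (e * r ^+ 2 / (24 * B)).
have dl0 : 0 < dl by rewrite lt_min !(divr_gt0, mulr_gt0, exprn_gt0).
have [dlr dle] : dl <= r / 2 /\ dl <= e * r ^+ 2 / (24 * B).
  by rewrite !ge_min !lexx orbT.
exists dl => // w w' wd wd'.
have wQ : open_rect x1 x2 y1 y2 w by apply: wo; lra.
have wQ' : open_rect x1 x2 y1 y2 w' by apply: wo; lra.
pose D z := F z * ((z - w)^-1 * (z - w')^-1 - (z - z0)^-1 * (z - z0)^-1).
have DC : cdiff_on E D.
  apply: cdiff_onM => //; apply: cdiff_onD; first by apply: cdiff_onM; exact: pole.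
  have : cdiff_on E (fun z => -1 * ((z - z0)^-1 * (z - z0)^-1)).
    apply: cdiff_onM; first exact: cdiff_on_cst.
    by apply: cdiff_onM; exact: pole.
  by under eq_fun do rewrite mulN1r.
have ZC k g : cdiff_on E g -> cdiff_on E (fun z => k * g z).
  by move=> gE; apply: cdiff_onM => //; exact: cdiff_on_cst.
have key : n * (F w - F w' - K * (w - w')) =
    (w - w') * rectint x1 x2 y1 y2 D.
  have -> : n * (F w - F w' - K * (w - w')) =
      n * F w - (n * F w' + (w - w') * rectint x1 x2 y1 y2 q).
    by rewrite /K; field.
  rewrite !cauchy//.
  have C1 : cont_on E (fun z => F z / (z - w')).
    by apply: cdiff_on_cont; apply: cdiff_onM => //; exact: pole.
  have C2 := cdiff_on_cont (ZC (w - w') _ qC).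
  have C3 := cdiff_on_cont (ZC (w - w') _ DC).
  have C4 : cont_on E (fun z => F z / (z - w') + (w - w') * q z).
    apply: cdiff_on_cont; apply: cdiff_onD; last exact: ZC.
    by apply: cdiff_onM => //; exact: pole.
  have EE := @subset_refl _ E.
  rewrite -(rectintZ (w - w') x12 y12 EE (cdiff_on_cont qC)).
  rewrite -(rectintZ (w - w') x12 y12 EE (cdiff_on_cont DC)).
  rewrite -(rectintD x12 y12 EE C1 C2); apply/eqP; rewrite subr_eq; apply/eqP.
  rewrite addrC -(rectintD x12 y12 EE C4 C3).
  apply: eq_rectint => // z Ez; rewrite /q /D.
  have p1 := subr_neq0_sep Ez (open_rect_frame wQ).
  have p2 := subr_neq0_sep Ez (open_rect_frame wQ').
  have p3 := subr_neq0_sep Ez (open_rect_frame z0o).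
  by field; rewrite p1 p2 p3.
have DB z : E z -> normc (D z) <= B * (6 * dl * r^-1 ^+ 3).
  move=> Ez.
  have p1 := subr_neq0_sep Ez (open_rect_frame wQ).
  have p2 := subr_neq0_sep Ez (open_rect_frame wQ').
  have p3 := subr_neq0_sep Ez (open_rect_frame z0o).
  have zr : r <= normc (z - z0).
    have := ler_norm_Re (z - z0); have := ler_norm_Im (z - z0).
    rewrite ReD ReN ImD ImN; move: (normc (z - z0)) => nn.
    rewrite !ler_norml => /andP[] + + /andP[].
    by case: Ez => _ []; rewrite /x1 /x2 /y1 /y2 => ->; lra.
  have far u : normc (u - z0) < dl -> r / 2 <= normc (z - u).
    move=> ud; have := le_normcD (z - u) (u - z0); rewrite addrA subrK; lra.
  have i0 : normc (z - z0)^-1 <= r^-1.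
    by rewrite normcV lef_pV2 ?posrE// (lt_le_trans rp).
  have i1 u : normc (u - z0) < dl -> normc (z - u)^-1 <= 2 * r^-1.
    move=> /far zu; have r2 : 0 < r / 2 by rewrite divr_gt0.
    rewrite normcV -[2]invrK -invfM mulrC lef_pV2 ?posrE//; exact: lt_le_trans zu.
  have ri : 0 < r^-1 by rewrite invr_gt0.
  have dif u : normc (u - z0) < dl -> z - u != 0 ->
      normc ((z - u)^-1 - (z - z0)^-1) <= dl * (r^-1 * (2 * r^-1)).
    move=> ud pu; have -> : (z - u)^-1 - (z - z0)^-1 =
      (u - z0) * ((z - z0)^-1 * (z - u)^-1) by field; rewrite p3 pu.
    rewrite !normcM; apply: ler_pM; rewrite ?mulr_ge0 ?normc_ge0//; first exact: ltW.
    by apply: ler_pM; rewrite ?normc_ge0//; exact: i1.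
  rewrite /D normcM; apply: ler_pM; rewrite ?normc_ge0//; first exact: FB.
  have -> : (z - w)^-1 * (z - w')^-1 - (z - z0)^-1 * (z - z0)^-1 =
     ((z - w)^-1 - (z - z0)^-1) * (z - w')^-1 +
     (z - z0)^-1 * ((z - w')^-1 - (z - z0)^-1) by ring.
  apply: le_trans (le_normcD _ _) _; rewrite !normcM.
  have -> : 6 * dl * r^-1 ^+ 3 = dl * (r^-1 * (2 * r^-1)) * (2 * r^-1) +
     r^-1 * (dl * (r^-1 * (2 * r^-1))) by ring.
  by apply: lerD; apply: ler_pM; rewrite ?normc_ge0//; [exact: dif|exact: i1|exact: dif].
have IB := ler_normc_rectint x12 y12 (@subset_refl _ E) (cdiff_on_cont DC) DB.
have per : (x2 - x1) + (y2 - y1) = 4 * r by rewrite /x1 /x2 /y1 /y2; ring.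
rewrite per in IB.
have IB' : normc (rectint x1 x2 y1 y2 D) <= 4 * e.
  apply: le_trans IB _.
  have -> : 4 * (B * (6 * dl * r^-1 ^+ 3)) * (4 * r) = 4 * (dl * (24 * B / r ^+ 2)).
    by field; rewrite gt_eqF.
  rewrite ler_wpM2l// mulrA ler_pdivrMr ?exprn_gt0//.
  by move: dle; rewrite ler_pdivlMr// mulr_gt0.
have : normc n * normc (F w - F w' - K * (w - w')) <= 4 * e * normc (w - w').
  rewrite -normcM key normcM mulrC ler_wpM2r ?normc_ge0//.
have := normc_ge0 (F w - F w' - K * (w - w')); nra.
Qed.

End CauchyFormula.

(** * Strict differentiability and local inversion *)

(** Matrices over a complete field are complete for their norm; this joins the
    two structures for the sake of the contraction principle. *)
HB.instance Definition _ (R : realType) (m n : nat) := Complete.on 'M[R]_(m, n).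

Section StrictDifferential.
Variable R : realType.

Lemma norm_coord_le (K : numFieldType) n (v : 'rV[K]_n) i : `|v 0 i| <= `|v|.
Proof.
rewrite -[leRHS]/(mx_norm v) mx_normE -[leLHS]nngE num_le.
exact: (le_bigmax _ _ (0, i)).
Qed.

Lemma norm_row_le n (v : 'rV[R]_n) (c : R) : 0 <= c ->
  (forall i, `|v 0 i| <= c) -> `|v| <= c.
Proof.
move=> c0 vc; rewrite -[leLHS]/(mx_norm v) mx_normrE.
by apply: bigmax_le => // -[j i] _ /=; rewrite ord1.
Qed.

Lemma norm_mulmx_le m n (M : 'M[R]_(m, n)) :
  exists2 C : R, 0 < C & forall v : 'rV_m, `|v *m M| <= C * `|v|.
Proof.
exists (1 + \sum_i \sum_j `|M i j|).
  by rewrite ltr_pwDl// sumr_ge0// => i _; rewrite sumr_ge0.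
move=> v; have S0 : 0 <= \sum_i \sum_j `|M i j|.
  by rewrite sumr_ge0// => i _; rewrite sumr_ge0.
apply: norm_row_le => [|j]; first by rewrite mulr_ge0// addr_ge0.
rewrite mxE; apply: le_trans (ler_norm_sum _ _ _) _.
rewrite mulrDl mul1r; apply: ler_wpDl => //; rewrite mulr_suml.
apply: ler_sum => i _; rewrite normrM mulrC ler_pM ?norm_coord_le//.
by rewrite (bigD1 j)//= lerDl sumr_ge0.
Qed.

Definition strict_diff n (f : 'rV[R]_n -> 'rV[R]_n) (q : 'rV[R]_n) (M : 'M[R]_n) :=
  forall e : R, 0 < e -> exists2 d : R, 0 < d & forall x y,
    `|x - q| < d -> `|y - q| < d -> `|f x - f y - (x - y) *m M| <= e * `|x - y|.

Lemma strict_diff_diffE n (f : 'rV[R]_n -> 'rV[R]_n) q M : strict_diff f q M ->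
  'd f q =1 (fun h : 'rV[R]_n => h *m M).
Proof.
move=> fM h0; rewrite -[RHS]/(mulmxr M h0); congr (_ h0).
apply: (@diff_unique R 'rV[R]_n 'rV[R]_n f (mulmxr M) q).
  have [C C0 MC] := norm_mulmx_le M.
  apply: (@bounded_linear_continuous _ _ _ (mulmxr M)).
  by apply/linear_boundedP; near=> r => x /=; apply: le_trans (MC x) _;
    rewrite ler_wpM2r.
apply/landau.eqaddoP => e e0; have [d d0 fd] := fM e e0.
apply/nbhs_ballP; exists d => //= h; rewrite -ball_normE /= sub0r normrN => hd.
have -> : (f \o shift q - (cst (f q) + mulmxr M)) h = f (h + q) - f q - (h + q - q) *m M.
  by rewrite addrK; rewrite /= /cst -[LHS]/(f (h + q) - (f q + h *m M)) opprD addrA.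
have := fd (h + q) q; rewrite addrK => /(_ hd); apply.
by rewrite subrr normr0.
Unshelve. all: by end_near. Qed.

(** To solve g x = v for v near g x0, take the fixed point of the contraction
    x |-> x - g x + v of a small closed ball around x0. *)
Lemma near_identity_open_map (V : completeNormedModType R) (O : set V) (g : V -> V) :
  open O -> (forall x y, O x -> O y -> `|g x - g y - (x - y)| <= 2^-1 * `|x - y|) ->
  open (g @` O).
Proof.
move=> oO gO; rewrite openE => _ [x0 Ox0 <-].
have := open_nbhs_nbhs (conj oO Ox0); rewrite nbhs_ballP => -[r r0 rO].
have r20 : 0 < r / 2 by rewrite divr_gt0.
pose U : set V := closed_ball_ Num.norm x0 (r / 2).
have UO : U `<=` O.
  move=> x Ux; apply: rO; rewrite -ball_normE /=; apply: le_lt_trans Ux _.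
  by rewrite gtr_pMr// invf_lt1// ltr1n.
have Ux0 : U x0 by rewrite /U /closed_ball_ /= subrr normr0 ltW.
apply/nbhs_ballP; exists (r / 4); first by rewrite /= divr_gt0.
move=> v; rewrite -ball_normE /= => vr.
pose T x := x - g x + v.
have TL x y : O x -> O y -> `|T x - T y| <= 2^-1 * `|x - y|.
  move=> Ox Oy; have -> : T x - T y = - (g x - g y - (x - y)).
    by rewrite /T opprD addrACA subrr addr0 opprD opprK addrACA !opprB [- _ + _]addrC.
  by rewrite normrN; exact: gO.
have TU : {homo T : x / U x >-> U x}.
  move=> x Ux; rewrite /U /closed_ball_ /=.
  have x0E : x0 = T x0 + (g x0 - v) by rewrite /T [g x0 - v]addrC addrA addrK subrK.
  rewrite {1}x0E addrAC.
  apply: le_trans (ler_normD _ _) _.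
  apply: le_trans (lerD (TL _ _ (UO _ Ux0) (UO _ Ux)) (ltW vr)) _.
  move: Ux; rewrite /U /closed_ball_ /= => Ux; lra.
have [|//||p Up Tp] := @banach_fixed_point _ V U (mkfun TU).
- exists (2^-1)%:nng; split=> /=; first by rewrite invf_lt1// ltr1n.
  by move=> [x y] [/= Ux Uy]; apply: TL; exact: UO.
- by rewrite /U -closed_ballE//; exact: closed_ball_closed.
- by exists x0.
exists p; first exact: UO.
move: Tp => /= /eqP; rewrite /mkfun /T -addrA -[X in X == _]addr0 (inj_eq (addrI p)).
by rewrite eq_sym addrC subr_eq0 => /eqP.
Qed.

(** If M is the differential at q, then x |-> f x M^-1 is close to the identity
    near q, hence open and bounded below.  The lower bound
    |x - y| <= 2 C |f x - f y| passes to the differentials at nearby points,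
    which are therefore injective. *)
Lemma strict_diff_sheet n (f : 'rV[R]_n -> 'rV[R]_n) (U : set 'rV[R]_n) q :
  open U -> (forall x, U x -> exists M, strict_diff f x M) -> U q ->
  bijective ('d f q : 'rV[R]_n -> 'rV[R]_n) ->
  exists W : set 'rV[R]_n,
    [/\ open W, W q,
        W `<=` U `\` [set x | U x /\ ~ bijective ('d f x : 'rV[R]_n -> 'rV[R]_n)],
        {in W &, injective f} &
        forall O, open O -> open (f @` (W `&` O))].
Proof.
move=> oU fU Uq; have [M fM] := fU q Uq.
have mx_bij (N : 'M[R]_n) : (forall v : 'rV[R]_n, v *m N = 0 -> v = 0) ->
    N \in unitmx.
  by move=> /inj_row_free; rewrite row_free_unit.
move=> /eq_bij/(_ _ (strict_diff_diffE fM))/bij_inj Minj.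
have Mu : M \in unitmx by apply: mx_bij => v vM; apply: Minj; rewrite vM mul0mx.
have [C C0 MC] := norm_mulmx_le (invmx M).
have [d d0 fd] : exists2 d : R, 0 < d & forall x y, `|x - q| < d -> `|y - q| < d ->
    `|f x *m invmx M - f y *m invmx M - (x - y)| <= 2^-1 * `|x - y|.
  have e0 : 0 < 2^-1 / C by rewrite divr_gt0.
  have [d d0 fd] := fM _ e0; exists d => // x y xq yq.
  have -> : f x *m invmx M - f y *m invmx M - (x - y) =
      (f x - f y - (x - y) *m M) *m invmx M.
    by rewrite mulmxBl [(f x - f y) *m _]mulmxBl mulmxK.
  apply: le_trans (MC _) _; apply: le_trans (ler_wpM2l (ltW C0) (fd x y xq yq)) _.
  by rewrite mulrA [C * _]mulrC divfK// gt_eqF.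
pose W := U `&` ball q d.
have Wd x : W x -> `|x - q| < d.
  by move=> [_]; rewrite -ball_normE /= distrC.
have oW : open W by apply: openI => //; exact: ball_open.
have Wlow x y : W x -> W y -> `|x - y| <= 2 * C * `|f x - f y|.
  move=> Wx Wy; have := fd x y (Wd x Wx) (Wd y Wy).
  rewrite -mulmxBl => H; have := MC (f x - f y).
  set u := _ *m invmx M in H *; have := ler_normB u (u - (x - y)).
  rewrite subKr; lra.
exists W; split => //.
- by split=> //; exact: ballxx.
- move=> x Wx; split; first by case: Wx.
  move=> [_]; apply; have [N fN] := fU x Wx.1.
  have Nu : N \in unitmx.
    apply: mx_bij => v vN; apply/eqP; apply: contraT => v0.
    have nv : 0 < `|v| by rewrite normr_gt0.
    have e0 : 0 < (4 * C)^-1 by rewrite invr_gt0 mulr_gt0.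
    have [d' d'0 fd'] := fN _ e0.
    have [r /= r0 rW] : exists2 r : R, 0 < r & ball x r `<=` W.
      by have := open_nbhs_nbhs (conj oW Wx); rewrite nbhs_ballP => -[r r0 rW]; exists r.
    (* A multiple of v so short that x and t v + x satisfy all estimates. *)
    pose t := Num.min d' r / 2 / `|v|.
    have m0 : 0 < Num.min d' r by rewrite lt_min d'0.
    have t0 : 0 < t by rewrite !divr_gt0.
    have tv : `|t *: v| = Num.min d' r / 2 by rewrite normrZ gtr0_norm// divfK// gt_eqF.
    have tv2 : `|t *: v| < Num.min d' r by rewrite tv gtr_pMr// invf_lt1// ltr1n.
    have Wt : W (t *: v + x).
      apply: rW; rewrite -ball_normE /= opprD addrCA subrr addr0 normrN.
      by apply: lt_le_trans tv2 _; rewrite ge_min lexx orbT.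
    have := Wlow _ _ Wt Wx; rewrite addrK => E1.
    have := fd' (t *: v + x) x; rewrite addrK subrr normr0.
    rewrite -scalemxAl vN scaler0 subr0 => E2.
    have {}E2 : `|f (t *: v + x) - f x| <= (4 * C)^-1 * `|t *: v|.
      by apply: E2 => //; apply: lt_le_trans tv2 _; rewrite ge_min lexx.
    have : `|t *: v| <= 2 * C * ((4 * C)^-1 * `|t *: v|).
      by apply: le_trans E1 _; rewrite ler_wpM2l// mulr_ge0// ltW.
    have -> : 2 * C * ((4 * C)^-1 * `|t *: v|) = `|t *: v| / 2.
      by field; rewrite gt_eqF.
    by rewrite tv; lra.
  apply: (eq_bij _ (fsym (strict_diff_diffE fN))).
  by exists (fun v => v *m invmx N) => v; rewrite ?mulmxK// mulmxKV.
- move=> x y /set_mem Wx /set_mem Wy fxy; have := Wlow x y Wx Wy.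
  by rewrite fxy subrr normr0 mulr0 normr_le0 subr_eq0 => /eqP.
- move=> O oO; have oWO : open (W `&` O) by exact: openI.
  have := @near_identity_open_map 'rV[R]_n (W `&` O) (fun x => f x *m invmx M) oWO.
  have H x y : (W `&` O) x -> (W `&` O) y ->
      `|f x *m invmx M - f y *m invmx M - (x - y)| <= 2^-1 * `|x - y|.
    by move=> [Wx _] [Wy _]; apply: fd; exact: Wd.
  move=> /(_ H) oimg.
  have -> : f @` (W `&` O) = (fun v : 'rV[R]_n => v *m invmx M) @^-1`
      ((fun x => f x *m invmx M) @` (W `&` O)).
    apply/seteqP; split=> [_ [x WOx <-]|v [x WOx fx]]; exists x => //.
    by rewrite -[v](mulmxKV Mu) -fx mulmxKV.
  apply: open_comp oimg => v _.
  have lin : continuous (mulmxr (invmx M) : 'rV[R]_n -> 'rV[R]_n).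
    apply: (@bounded_linear_continuous _ _ _ (mulmxr (invmx M))).
    by apply/linear_boundedP; near=> r => x /=; apply: le_trans (MC x) _;
      rewrite ler_wpM2r.
  exact: lin.
Unshelve. all: by end_near. Qed.

End StrictDifferential.

(** * Stem functions *)

Section HolomorphicStem.
Variable R : realType.
Implicit Types (D : set R[i]) (F : R[i] -> cquat R) (z w : R[i]).

Lemma normCE (z : R[i]) : `|z| = (normc z)%:C. Proof. by []. Qed.

Lemma open_contains_rect D z : open (D : set R[i]^o) -> D z ->
  exists2 r : R, 0 < r & rect (Re z - r) (Re z + r) (Im z - r) (Im z + r) `<=` D.
Proof.
move=> oD Dz; have := open_nbhs_nbhs (conj oD Dz : open_nbhs (z : R[i]^o) D).
rewrite nbhs_ballP => -[[e e'] /=]; rewrite ltcE /= => /andP[/eqP e'0 e0] eD.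
exists (e / 3); first by rewrite divr_gt0.
move=> w [/andP[w1 w2] /andP[w3 w4]]; apply: eD; rewrite -ball_normE /=.
rewrite normCE ltcE /= e'0 eqxx /=.
apply: le_lt_trans (ler_normc_ReIm _) _; rewrite ReD ImD ReN ImN.
apply: le_lt_trans (_ : e / 3 + e / 3 < e); last by lra.
by apply: lerD; rewrite ler_norml; lra.
Qed.

Lemma holomorphic_cdiff D F k : holomorphic_on D F ->
  cdiff_on D (fun z => F z 0 k).
Proof.
move=> FD z Dz; have := diff_locallyx (FD z Dz) => /funext/landau.eqaddoP FL.
set dF := 'd (F : R[i]^o -> cquat R) (z : R[i]^o) in FL.
exists ((dF 1 : cquat R) 0 k) => e e0.
have := FL e%:C; rewrite ltcR => /(_ e0) /nbhs_ballP[[d d'] /=].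
rewrite ltcE /= => /andP[/eqP d'0 d0] dF'; exists d => // w Dw wd.
have : ball (0 : R[i]^o) (d +i* d') (w - z).
  by rewrite -ball_normE /= sub0r normrN normCE ltcE /= d'0 eqxx.
move=> /dF'; set v := (X in `|X| <= _) => /(le_trans (norm_coord_le v k)).
have -> : v 0 k = F w 0 k - F z 0 k - (dF 1 : cquat R) 0 k * (w - z).
  have dE : dF (w - z) = (w - z) *: dF 1.
    by rewrite -linearZ; congr (dF _); rewrite -[RHS]/((w - z) * 1) mulr1.
  rewrite /v -[LHS]/((F (w - z + z) - (F z + dF (w - z))) 0 k) subrK dE.
  by rewrite !mxE opprD addrA [_ * (w - z)]mulrC.
by rewrite !normCE -rmorphM /= lecR.
Qed.

End HolomorphicStem.

(** * Calculus of strictly differentiable scalar functions *)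

Section ScalarStrictDifferential.
Variables (R : realType) (n : nat).
Implicit Types (g : 'rV[R]_n -> R) (q x y : 'rV[R]_n) (h : R -> R -> R).

Definition strict_diff1 g q := exists a : 'cV[R]_n, forall e : R, 0 < e ->
  exists2 d : R, 0 < d & forall x y, `|x - q| < d -> `|y - q| < d ->
    `|g x - g y - ((x - y) *m a) 0 0| <= e * `|x - y|.

(** Strict differentiability of a function of two real variables.  Functions of
    one variable are covered by ignoring the second, so that one composition
    lemma gives sums, products, roots and inverses. *)
Definition strict_diff2 h (u0 v0 : R) := exists A B : R, forall e : R, 0 < e ->
  exists2 d : R, 0 < d & forall u v u' v', `|u - u0| < d -> `|v - v0| < d ->
    `|u' - u0| < d -> `|v' - v0| < d ->
    `|h u v - h u' v' - A * (u - u') - B * (v - v')| <= e * (`|u - u'| + `|v - v'|).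

Lemma strict_diff1_lipschitz g q : strict_diff1 g q ->
  exists2 C : R, 0 < C & exists2 d : R, 0 < d & forall x y,
    `|x - q| < d -> `|y - q| < d -> `|g x - g y| <= C * `|x - y|.
Proof.
move=> [a ga]; have [C C0 aC] := norm_mulmx_le a; exists (1 + C).
  by rewrite addr_gt0.
have [d d0 gd] := ga 1 ltr01; exists d => // x y xq yq.
have := gd x y xq yq; have := aC (x - y); have := norm_coord_le ((x - y) *m a) 0.
set t := (_ *m a) 0 0; have := ler_normD (g x - g y - t) t; rewrite subrK; lra.
Qed.

Lemma strict_diff1_comp2 h g1 g2 q : strict_diff2 h (g1 q) (g2 q) ->
  strict_diff1 g1 q -> strict_diff1 g2 q ->
  strict_diff1 (fun x => h (g1 x) (g2 x)) q.
Proof.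
move=> [A [B hAB]] g1q g2q.
have [C1 C10 [d1 d10 L1]] := strict_diff1_lipschitz g1q.
have [C2 C20 [d2 d20 L2]] := strict_diff1_lipschitz g2q.
have [a1 G1] := g1q; have [a2 G2] := g2q.
exists (A *: a1 + B *: a2) => e e0.
pose M := C1 + C2 + `|A| + `|B|.
have M0 : 0 < M by rewrite /M -addrA ltr_wpDr ?addr_ge0// addr_gt0.
have e1 : 0 < e / M by rewrite divr_gt0.
have [d3 d30 H] := hAB _ e1.
have [d4 d40 {}G1] := G1 _ e1; have [d5 d50 {}G2] := G2 _ e1.
pose d := Num.min (Num.min (Num.min d1 d2) (Num.min d4 d5))
                  (Num.min (d3 / C1) (d3 / C2)).
exists d; first by rewrite /d !lt_min d10 d20 d40 d50 !divr_gt0.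
have dP x : `|x - q| < d -> [/\ `|x - q| < d1, `|x - q| < d2, `|x - q| < d4,
    `|x - q| < d5 & `|g1 x - g1 q| < d3 /\ `|g2 x - g2 q| < d3].
  rewrite /d !lt_min => /andP[/andP[/andP[h1 h2] /andP[h4 h5]] /andP[h6 h7]].
  have qq b : 0 < b -> `|q - q| < b by rewrite subrr normr0.
  split=> //; split.
  - by apply: le_lt_trans (L1 x q h1 (qq _ d10)) _; rewrite mulrC -ltr_pdivlMr.
  - by apply: le_lt_trans (L2 x q h2 (qq _ d20)) _; rewrite mulrC -ltr_pdivlMr.
move=> x y /dP[x1 x2 x4 x5 [xg1 xg2]] /dP[y1 y2 y4 y5 [yg1 yg2]].
have E1 := H _ _ _ _ xg1 xg2 yg1 yg2.
have E2 := L1 x y x1 y1; have E3 := L2 x y x2 y2.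
have E4 := G1 x y x4 y4; have E5 := G2 x y x5 y5.
have -> : ((x - y) *m (A *: a1 + B *: a2)) 0 0 =
    A * ((x - y) *m a1) 0 0 + B * ((x - y) *m a2) 0 0.
  by rewrite mulmxDr -!scalemxAr !mxE.
set t1 := ((x - y) *m a1) 0 0 in E4 *; set t2 := ((x - y) *m a2) 0 0 in E5 *.
set r1 := g1 x - g1 y - t1 in E4; set r2 := g2 x - g2 y - t2 in E5.
set s := h _ _ - h _ _ - _ - _ in E1.
have -> : h (g1 x) (g2 x) - h (g1 y) (g2 y) - (A * t1 + B * t2) =
    s + (A * r1 + B * r2) by rewrite /s /r1 /r2; ring.
have -> : e * `|x - y| = e / M * `|x - y| * M by rewrite mulrAC divfK// gt_eqF.
apply: le_trans (ler_normD _ _) _.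
apply: le_trans (lerD E1 (ler_normD _ _)) _; rewrite !normrM.
have F1 : `|A| * `|r1| <= `|A| * (e / M * `|x - y|) by rewrite ler_wpM2l.
have F2 : `|B| * `|r2| <= `|B| * (e / M * `|x - y|) by rewrite ler_wpM2l.
have F3 : e / M * (`|g1 x - g1 y| + `|g2 x - g2 y|) <=
    e / M * (C1 * `|x - y| + C2 * `|x - y|).
  by rewrite ler_wpM2l ?(ltW e1)// lerD.
have -> : e / M * `|x - y| * M = e / M * (C1 * `|x - y| + C2 * `|x - y|) +
  (`|A| * (e / M * `|x - y|) + `|B| * (e / M * `|x - y|)) by rewrite {2}/M; ring.
by rewrite lerD// lerD.
Qed.

Lemma strict_diff1_coord i q : strict_diff1 (fun x => x 0 i) q.
Proof.
exists (delta_mx i 0) => e e0; exists 1 => // x y _ _.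
by rewrite -colE !mxE subrr normr0 mulr_ge0// ltW.
Qed.

Lemma strict_diff2D u v : strict_diff2 (fun u v => u + v) u v.
Proof.
exists 1, 1 => e e0; exists 1 => // a b c d _ _ _ _.
have -> : a + b - (c + d) - 1 * (a - c) - 1 * (b - d) = 0 by ring.
by rewrite normr0 mulr_ge0 ?addr_ge0// ltW.
Qed.

Lemma strict_diff2N u v : strict_diff2 (fun u _ => - u) u v.
Proof.
exists (-1), 0 => e e0; exists 1 => // a b c d _ _ _ _.
have -> : - a - - c - -1 * (a - c) - 0 * (b - d) = 0 by ring.
by rewrite normr0 mulr_ge0 ?addr_ge0// ltW.
Qed.

Lemma strict_diff2M u v : strict_diff2 (fun u v => u * v) u v.
Proof.
exists v, u => e e0; exists e => // a b c d h1 h2 h3 h4.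
have -> : a * b - c * d - v * (a - c) - u * (b - d) =
  (b - v) * (a - c) + (c - u) * (b - d) by ring.
apply: le_trans (ler_normD _ _) _; rewrite !normrM mulrDr.
by apply: lerD; apply: ler_wpM2r => //; exact: ltW.
Qed.

Lemma strict_diff2_sqrt u v : 0 < u -> strict_diff2 (fun u _ => Num.sqrt u) u v.
Proof.
move=> u0; set s := Num.sqrt u; have s0 : 0 < s by rewrite sqrtr_gt0.
have s2 : s ^+ 2 = u by rewrite sqr_sqrtr// ltW.
have dsq t : 0 < t -> `|Num.sqrt t - s| <= `|t - u| / s.
  move=> t0; rewrite ler_pdivlMr//.
  have -> : t - u = (Num.sqrt t - s) * (Num.sqrt t + s).
    by rewrite -subr_sqr s2 sqr_sqrtr// ltW.
  rewrite normrM ler_wpM2l// ger0_norm; last by rewrite addr_ge0 ?sqrtr_ge0.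
  by rewrite lerDr sqrtr_ge0.
exists (2 * s)^-1, 0 => e e0.
exists (Num.min (u / 2) (e * s ^+ 3)).
  by rewrite lt_min divr_gt0 ?mulr_gt0 ?exprn_gt0.
have near t : `|t - u| < Num.min (u / 2) (e * s ^+ 3) ->
    [/\ 0 < t, s / 2 <= Num.sqrt t & `|Num.sqrt t - s| <= e * s ^+ 2].
  rewrite lt_min => /andP[t1 t2].
  have t0 : 0 < t by move: t1; rewrite ltr_norml; lra.
  have D := dsq t t0; split=> //.
    have : `|Num.sqrt t - s| <= s / 2.
      apply: le_trans D _; rewrite ler_pdivrMr// mulrAC -expr2 s2; exact: ltW.
    by rewrite ler_norml; lra.
  apply: le_trans D _; rewrite ler_pdivrMr// -mulrA -exprSr; exact: ltW.
move=> a b c d /near[a0 a1 a2] _ /near[c0 c1 c2] _.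
have aE : Num.sqrt a ^+ 2 = a by rewrite sqr_sqrtr// ltW.
have cE : Num.sqrt c ^+ 2 = c by rewrite sqr_sqrtr// ltW.
set p := Num.sqrt a in a1 a2 aE *; set r := Num.sqrt c in c1 c2 cE *.
rewrite mul0r subr0.
have pr0 : 0 < p + r by lra.
have -> : p - r - (2 * s)^-1 * (a - c) =
    (a - c) * (((s - p) + (s - r)) / (2 * s * (p + r))).
  by rewrite -aE -cE; field; rewrite !gt_eqF.
rewrite normrM mulrC; apply: le_trans (_ : e * `|a - c| <= _); last first.
  by rewrite ler_wpM2l ?lerDl// ltW.
have den : 0 < 2 * s * (p + r) by rewrite !mulr_gt0.
apply: ler_wpM2r => //; rewrite normrM normfV (gtr0_norm den) ler_pdivrMr//.
apply: le_trans (ler_normD _ _) _; rewrite ![`|s - _|]distrC.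
apply: le_trans (lerD a2 c2) _; rewrite -mulrDr ler_wpM2l ?(ltW e0)//.
have : s * s <= s * (p + r) by rewrite ler_wpM2l ?(ltW s0)//; lra.
lra.
Qed.

Lemma strict_diff2V u v : 0 < u -> strict_diff2 (fun u _ => u^-1) u v.
Proof.
move=> u0; exists (- u ^- 2), 0 => e e0.
exists (Num.min (u / 2) (e * u ^+ 3 / 12)).
  by rewrite lt_min !divr_gt0 ?mulr_gt0 ?exprn_gt0.
have near t : `|t - u| < Num.min (u / 2) (e * u ^+ 3 / 12) ->
    [/\ u / 2 <= t, t <= 2 * u & `|t - u| <= e * u ^+ 3 / 12].
  rewrite lt_min => /andP[t1 t2]; move: (t1); rewrite ltr_norml => /andP[t3 t4].
  by split; [lra|lra|exact: ltW].
move=> a b c d /near[a1 a2 a3] _ /near[c1 c2 c3] _.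
have a0 : 0 < a by lra. have c0 : 0 < c by lra.
rewrite mul0r subr0.
have -> : a^-1 - c^-1 - - u ^- 2 * (a - c) =
    (a - c) * (((a - u) * c + u * (c - u)) / (u ^+ 2 * (a * c))).
  by field; rewrite !gt_eqF.
rewrite normrM mulrC; apply: le_trans (_ : e * `|a - c| <= _); last first.
  by rewrite ler_wpM2l ?lerDl// ltW.
have den : 0 < u ^+ 2 * (a * c) by rewrite !mulr_gt0// exprn_gt0.
apply: ler_wpM2r => //; rewrite normrM normfV (gtr0_norm den) ler_pdivrMr//.
apply: le_trans (ler_normD _ _) _; rewrite !normrM (gtr0_norm c0) (gtr0_norm u0).
apply: le_trans (_ : e * (u ^+ 2 * (u / 2 * (u / 2))) <= _); last first.
  by rewrite !ler_wpM2l ?sqr_ge0 ?(ltW e0)//; apply: ler_pM => //; rewrite divr_ge0// ltW.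
have -> : e * (u ^+ 2 * (u / 2 * (u / 2))) =
    e * u ^+ 3 / 12 * (2 * u) + u * (e * u ^+ 3 / 12) by field.
have m0 : 0 <= e * u ^+ 3 / 12 by rewrite divr_ge0// mulr_ge0 ?exprn_ge0 ?ltW.
by apply: lerD; [apply: ler_pM => //; exact: ltW|rewrite ler_wpM2l// (ltW u0)].
Qed.

Lemma strict_diff1D g1 g2 q : strict_diff1 g1 q -> strict_diff1 g2 q ->
  strict_diff1 (fun x => g1 x + g2 x) q.
Proof. by move=> *; apply: strict_diff1_comp2 => //; exact: strict_diff2D. Qed.

Lemma strict_diff1M g1 g2 q : strict_diff1 g1 q -> strict_diff1 g2 q ->
  strict_diff1 (fun x => g1 x * g2 x) q.
Proof. by move=> *; apply: strict_diff1_comp2 => //; exact: strict_diff2M. Qed.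

Lemma strict_diff1N g q : strict_diff1 g q -> strict_diff1 (fun x => - g x) q.
Proof.
by move=> gq; apply: (strict_diff1_comp2 (strict_diff2N (g q) (g q))).
Qed.

Lemma strict_diff1B g1 g2 q : strict_diff1 g1 q -> strict_diff1 g2 q ->
  strict_diff1 (fun x => g1 x - g2 x) q.
Proof. by move=> g1q g2q; apply: strict_diff1D => //; exact: strict_diff1N. Qed.

Lemma strict_diff1_sqrt g q : 0 < g q -> strict_diff1 g q ->
  strict_diff1 (fun x => Num.sqrt (g x)) q.
Proof.
move=> g0 gq; apply: (strict_diff1_comp2 (strict_diff2_sqrt (g q) g0)) => //.
Qed.

Lemma strict_diff1V g q : 0 < g q -> strict_diff1 g q ->
  strict_diff1 (fun x => (g x)^-1) q.
Proof.
move=> g0 gq; apply: (strict_diff1_comp2 (strict_diff2V (g q) g0)) => //.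
Qed.

End ScalarStrictDifferential.

(** The gradients of the coordinates are the columns of the matrix. *)
Lemma strict_diff_of_coord (R : realType) n (f : 'rV[R]_n -> 'rV[R]_n)
    (g : 'I_n -> 'rV[R]_n -> R) (U : set 'rV[R]_n) q : open U -> U q ->
  (forall x i, U x -> f x 0 i = g i x) ->
  (forall i, strict_diff1 (g i) q) -> exists M, strict_diff f q M.
Proof.
move=> oU Uq fg gq; have [a aP] := choice gq.
exists (\matrix_(i, j) a j i 0) => e e0.
have /choice[d dP] (i : 'I_n) : exists d : R, 0 < d /\ forall x y,
    `|x - q| < d -> `|y - q| < d ->
    `|g i x - g i y - ((x - y) *m a i) 0 0| <= e * `|x - y|.
  by have [d d0 dP] := aP i e e0; exists d.
have [r /= r0 rU] : exists2 r : R, 0 < r & ball q r `<=` U.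
  by have := open_nbhs_nbhs (conj oU Uq); rewrite nbhs_ballP => -[r r0 rU]; exists r.
pose m := \big[Num.min/r]_i d i.
exists m.
  by rewrite /m; apply: (big_ind (fun t => 0 < t)) => // [s t s0 t0|i _];
    rewrite ?lt_min ?s0//; have [] := dP i.
have mU x : `|x - q| < m -> U x /\ forall i, `|x - q| < d i.
  move=> xm; split; last by move=> i; apply: lt_le_trans xm _; exact: bigmin_le.
  apply: rU; rewrite -ball_normE /= distrC; apply: lt_le_trans xm _.
  exact: bigmin_le_id.
move=> x y /mU[Ux xd] /mU[Uy yd].
apply: norm_row_le => [|i]; first by rewrite mulr_ge0// ltW.
rewrite !mxE !fg//; have [_ /(_ x y (xd i) (yd i))] := dP i.
rewrite mxE; congr (`|_ - _| <= _); apply: eq_bigr => j _; by rewrite !mxE.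
Qed.

(** * Slice functions *)

Section SliceFunctions.
Variable R : realType.
Implicit Types (D : set R[i]) (F : R[i] -> cquat R) (z w : R[i]) (p q I J : quat R).

Local Notation co q n := ((q : 'rV[R]_4) 0 (inord n : 'I_4)).

Lemma ord4P (P : 'I_4 -> Prop) : P (inord 0) -> P (inord 1) -> P (inord 2) ->
  P (inord 3) -> forall i, P i.
Proof.
move=> P0 P1 P2 P3 [[|[|[|[|//]]]] lt_i4].
- by have -> : Ordinal lt_i4 = inord 0 by apply: val_inj; rewrite /= inordK.
- by have -> : Ordinal lt_i4 = inord 1 by apply: val_inj; rewrite /= inordK.
- by have -> : Ordinal lt_i4 = inord 2 by apply: val_inj; rewrite /= inordK.
- by have -> : Ordinal lt_i4 = inord 3 by apply: val_inj; rewrite /= inordK.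
Qed.

Lemma mkquatE (a b c d : R) : [/\ co (mkquat a b c d) 0 = a,
  co (mkquat a b c d) 1 = b, co (mkquat a b c d) 2 = c & co (mkquat a b c d) 3 = d].
Proof. by split; rewrite mxE inordK. Qed.

Lemma quat_eq p q : co p 0 = co q 0 -> co p 1 = co q 1 -> co p 2 = co q 2 ->
  co p 3 = co q 3 -> p = q.
Proof. by move=> *; apply/rowP; exact: ord4P. Qed.

Definition qradius q : R := Num.sqrt (co q 1 ^+ 2 + co q 2 ^+ 2 + co q 3 ^+ 2).

(** The point z in the closed upper half plane with q = pi_C z I. *)
Definition qpoint q : R[i] := co q 0 +i* qradius q.

(** The imaginary unit of q; it is 0 when q is real, because 0^-1 = 0. *)
Definition qdir q : quat R := (qradius q)^-1 *: (q - quat_real (co q 0)).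

Lemma qdirE q : [/\ co (qdir q) 0 = 0, co (qdir q) 1 = (qradius q)^-1 * co q 1,
  co (qdir q) 2 = (qradius q)^-1 * co q 2 & co (qdir q) 3 = (qradius q)^-1 * co q 3].
Proof.
have [r0 r1 r2 r3] := mkquatE (co q 0) 0 0 0.
split; rewrite !mxE -[nth _ _ _]/(_`_ _) inordK//=.
- by rewrite subrr mulr0.
- by rewrite subr0.
- by rewrite subr0.
- by rewrite subr0.
Qed.

Lemma qradius_ge0 q : 0 <= qradius q. Proof. exact: sqrtr_ge0. Qed.

Lemma sqr_qradius q : qradius q ^+ 2 = co q 1 ^+ 2 + co q 2 ^+ 2 + co q 3 ^+ 2.
Proof. by rewrite sqr_sqrtr// !addr_ge0// sqr_ge0. Qed.

Lemma ler_coord_qradius q : [/\ `|co q 1| <= qradius q, `|co q 2| <= qradius q &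
  `|co q 3| <= qradius q].
Proof.
by split; rewrite -sqrtr_sqr ler_wsqrtr//; have := sqr_ge0 (co q 1);
  have := sqr_ge0 (co q 2); have := sqr_ge0 (co q 3); lra.
Qed.

Lemma imag_unitsP I : imag_units I <->
  co I 0 = 0 /\ co I 1 ^+ 2 + co I 2 ^+ 2 + co I 3 ^+ 2 = 1.
Proof.
rewrite /imag_units /= /qmul /=.
set a := co I 0; set b := co I 1; set c := co I 2; set d := co I 3.
have [m0 m1 m2 m3] := mkquatE (a * a - b * b - c * c - d * d)
  (a * b + b * a + c * d - d * c) (a * c - b * d + c * a + d * b)
  (a * d + b * c - c * b + d * a).
have [r0 r1 r2 r3] := mkquatE 1 0 0 (0 : R).
have N n : co (- quat_real 1) n = - co (quat_real 1 : quat R) n by rewrite mxE.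
split=> [E|[a0 bcd]].
- move: m0 m1 m2 m3; rewrite E !N r0 r1 r2 r3 => e0 e1 e2 e3.
  suff a0 : a = 0 by split=> //; rewrite a0 in e0; lra.
  apply/eqP; apply: contraT => an0.
  have f x : a * x = 0 -> x = 0 by move/eqP; rewrite mulf_eq0 (negPf an0) => /eqP.
  have b0 : b = 0 by apply: f; lra.
  have c0 : c = 0 by apply: f; lra.
  have d0 : d = 0 by apply: f; lra.
  by rewrite b0 c0 d0 in e0; have := sqr_ge0 a; lra.
- apply: quat_eq; rewrite N ?r0 ?r1 ?r2 ?r3 ?m0 ?m1 ?m2 ?m3 a0; lra.
Qed.

Lemma pi_CE z I : imag_units I -> [/\ co (pi_C z I) 0 = Re z,
  co (pi_C z I) 1 = Im z * co I 1, co (pi_C z I) 2 = Im z * co I 2 &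
  co (pi_C z I) 3 = Im z * co I 3].
Proof.
move=> /imag_unitsP[I0 _]; have [r0 r1 r2 r3] := mkquatE (Re z) 0 0 0.
by split; rewrite !mxE -[nth _ _ _]/(_`_ _) inordK//= ?I0 ?mulr0 ?addr0 ?add0r.
Qed.

Lemma qpoint_pi_C z I : imag_units I -> qpoint (pi_C z I) = Re z +i* `|Im z|.
Proof.
move=> Iu; rewrite /qpoint /qradius; have [-> -> -> ->] := pi_CE z Iu.
have [_ I1] := (imag_unitsP I).1 Iu.
by rewrite !exprMn -!mulrDr I1 mulr1 sqrtr_sqr.
Qed.

Lemma pi_C_qpoint q : exists2 I, imag_units I & q = pi_C (qpoint q) I /\
  (qradius q != 0 -> I = qdir q).
Proof.
have [b0|b0] := eqVneq (qradius q) 0.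
- exists (mkquat 0 1 0 0).
    apply/imag_unitsP; have [-> -> -> ->] := mkquatE 0 1 0 (0 : R).
    by rewrite expr1n expr0n/= !addr0.
  split=> //; have Iu : imag_units (mkquat 0 1 0 (0 : R)).
    apply/imag_unitsP; have [-> -> -> ->] := mkquatE 0 1 0 (0 : R).
    by rewrite expr1n expr0n/= !addr0.
  have [e0 e1 e2 e3] := pi_CE (qpoint q) Iu.
  have [c1 c2 c3] := ler_coord_qradius q; rewrite b0 !normr_le0 in c1 c2 c3.
  by apply: quat_eq; rewrite ?e0 ?e1 ?e2 ?e3 /= ?b0 ?mul0r//; exact/eqP.
- have Iu : imag_units (qdir q).
    apply/imag_unitsP; have [-> -> -> ->] := qdirE q; split=> //.
    by rewrite !exprMn -!mulrDr -sqr_qradius exprVn mulVf// expf_neq0.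
  exists (qdir q) => //; split=> //.
  have [e0 e1 e2 e3] := pi_CE (qpoint q) Iu; have [_ d1 d2 d3] := qdirE q.
  by apply: quat_eq; rewrite ?e0 ?e1 ?e2 ?e3 ?d1 ?d2 ?d3//= mulrA divff// mul1r.
Qed.

Lemma slice_domainP D q : (forall z, D z -> D (conjc z)) ->
  slice_domain D q <-> D (qpoint q).
Proof.
move=> Dc; split=> [[z [I [Dz Iu ->]]]|Dq].
- rewrite qpoint_pi_C//; case: z Dz => a b /= Dz.
  by case: (ger0P b) => // _; exact: (Dc _ Dz).
- by have [I Iu [qE _]] := pi_C_qpoint q; exists (qpoint q), I.
Qed.

Lemma stem_im0 D F z : stem_function D F -> D z -> Im z = 0 -> cq_im (F z) = 0.
Proof.
move=> FD Dz z0; have := FD z Dz.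
have -> : conjc z = z by move: z0; case: (z) => a b /= ->; rewrite oppr0.
move=> E; apply/rowP => i; rewrite !mxE.
have := congr1 (fun w : cquat R => Im (w 0 i)) E; rewrite mxE.
by case: (F z 0 i) => a b /= ?; lra.
Qed.

(** For real q the unit I is arbitrary, and qdir q = 0 may replace it because
    the imaginary part of F vanishes on the real axis. *)
Lemma slice_functionE D F (f : quat R -> quat R) q :
  stem_function D F -> induces D F f -> D (qpoint q) ->
  f q = pi_CH (F (qpoint q)) (qdir q).
Proof.
move=> FD Ff Dq; have [I Iu [qE IE]] := pi_C_qpoint q.
rewrite {1}qE Ff//; have [b0|/IE-> //] := eqVneq (qradius q) 0.
have im0 : cq_im (F (qpoint q)) = 0 by apply: (stem_im0 FD).
have qm0 J : qmul J 0 = 0.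
  have Z n : co (0 : quat R) n = 0 by rewrite mxE.
  rewrite /qmul !Z !mulr0 !subr0 !addr0.
  by apply/rowP; apply: ord4P; rewrite !mxE inordK.
by rewrite /pi_CH im0 !qm0.
Qed.

Lemma pi_CH_coord (w : cquat R) J (u := cq_re w) (v := cq_im w) : co J 0 = 0 ->
  [/\ co (pi_CH w J) 0 = co u 0 - co J 1 * co v 1 - co J 2 * co v 2 - co J 3 * co v 3,
      co (pi_CH w J) 1 = co u 1 + co J 1 * co v 0 + co J 2 * co v 3 - co J 3 * co v 2,
      co (pi_CH w J) 2 = co u 2 - co J 1 * co v 3 + co J 2 * co v 0 + co J 3 * co v 1 &
      co (pi_CH w J) 3 = co u 3 + co J 1 * co v 2 - co J 2 * co v 1 + co J 3 * co v 0].
Proof.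
move=> J0; rewrite /pi_CH -/u -/v.
have cD p q n : co (p + q) n = co p n + co q n by rewrite mxE.
by split; rewrite cD /qmul [X in _ + X = _]mxE inordK//= J0; ring.
Qed.

(** With b = |Im p| and b' = |Im q|, factor b^2 - b'^2 and the differences of
    squares of the coordinates, which are bounded by b and b'. *)
Lemma qradius_lipschitz p q : `|qradius p - qradius q| <= 3 * `|p - q|.
Proof.
have [p1 p2 p3] := ler_coord_qradius p; have [q1 q2 q3] := ler_coord_qradius q.
have Pp := sqr_qradius p; have Pq := sqr_qradius q.
have bp := qradius_ge0 p; have bq := qradius_ge0 q.
have c n : `|co p n - co q n| <= `|p - q|.
  by have := norm_coord_le ((p - q) : 'rV[R]_4) (inord n); rewrite !mxE.
have c1 := c 1; have c2 := c 2; have c3 := c 3.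
move: (qradius p) (qradius q) p1 p2 p3 q1 q2 q3 Pp Pq bp bq => b b' p1 p2 p3 q1 q2 q3 Pp Pq bp bq.
have [s0|s0] := eqVneq (b + b') 0.
  have -> : b - b' = 0 by lra.
  by rewrite normr0 mulr_ge0.
have {}s0 : 0 < b + b' by rewrite lt_def s0 addr_ge0.
rewrite -(ler_pM2r s0) -[X in _ * X <= _](gtr0_norm s0) -normrM.
have -> : (b - b') * (b + b') = (co p 1 - co q 1) * (co p 1 + co q 1) +
   (co p 2 - co q 2) * (co p 2 + co q 2) + (co p 3 - co q 3) * (co p 3 + co q 3).
  by rewrite -!subr_sqr Pp Pq; ring.
have t x y x' y' : `|x - y| <= `|p - q| -> `|x| <= x' -> `|y| <= y' ->
    `|(x - y) * (x + y)| <= `|p - q| * (x' + y').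
  move=> h1 h2 h3; rewrite normrM ler_pM//.
  by apply: le_trans (ler_normD _ _) _; exact: lerD.
have -> : 3 * `|p - q| * (b + b') = `|p - q| * (b + b') + `|p - q| * (b + b') +
  `|p - q| * (b + b') by ring.
apply: le_trans (ler_normD _ _) _; rewrite lerD ?t//.
by apply: le_trans (ler_normD _ _) _; rewrite lerD ?t.
Qed.

Lemma qpoint_lipschitz p q : normc (qpoint p - qpoint q) <= 4 * `|p - q|.
Proof.
apply: le_trans (ler_normc_ReIm _) _; rewrite /qpoint /=.
have := norm_coord_le ((p - q) : 'rV[R]_4) (inord 0); rewrite !mxE.
have := qradius_lipschitz p q; lra.
Qed.

Lemma open_slice_domain D : open (D : set R[i]^o) ->
  (forall z, D z -> D (conjc z)) -> open (slice_domain D).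
Proof.
move=> oD Dc; rewrite openE => q /(slice_domainP _ Dc) Dq.
have [r r0 rD] := open_contains_rect oD Dq.
apply/nbhs_ballP; exists (r / 4) => /=; first by rewrite divr_gt0.
move=> p; rewrite -ball_normE /= => pq; apply/(slice_domainP _ Dc); apply: rD.
have := qpoint_lipschitz p q; rewrite distrC in pq.
have := ler_norm_Re (qpoint p - qpoint q); have := ler_norm_Im (qpoint p - qpoint q).
rewrite ReD ReN ImD ImN; move: (normc _) => nn; rewrite !ler_norml => /andP[n1 n2] /andP[n3 n4] n5.
by split; apply/andP; split; lra.
Qed.

Definition strictC (g : R[i] -> R[i]) z K := forall e : R, 0 < e ->
  exists2 d : R, 0 < d & forall w w', normc (w - z) < d -> normc (w' - z) < d ->
    normc (g w - g w' - K * (w - w')) <= e * normc (w - w').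

Lemma ler_normc_pair (a b a' b' : R) :
  normc ((a +i* b) - (a' +i* b')) <= `|a - a'| + `|b - b'|.
Proof. exact: ler_normc_ReIm. Qed.

Lemma strictC_Re g z K : strictC g z K ->
  strict_diff2 (fun a b => Re (g (a +i* b))) (Re z) (Im z).
Proof.
move=> gK; exists (Re K), (- Im K) => e e0; have [d d0 gd] := gK e e0.
exists (d / 2); first by rewrite divr_gt0.
move=> u v u' v' u1 v1 u2 v2.
have near a b : `|a - Re z| < d / 2 -> `|b - Im z| < d / 2 -> normc ((a +i* b) - z) < d.
  move=> h1 h2; apply: le_lt_trans (ler_normc_ReIm _) _.
  by rewrite ReD ImD ReN ImN /=; lra.
have := gd _ _ (near _ _ u1 v1) (near _ _ u2 v2).
have := ler_norm_Re (g (u +i* v) - g (u' +i* v') - K * ((u +i* v) - (u' +i* v'))).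
rewrite !ReD !ReN ReM /= => h1 h2.
have h3 := ler_wpM2l (ltW e0) (ler_normc_pair u v u' v').
apply: le_trans (le_trans h2 h3); apply: le_trans h1.
by rewrite le_eqVlt; apply/orP; left; apply/eqP; congr (`|_|); ring.
Qed.

Lemma strictC_Im g z K : strictC g z K ->
  strict_diff2 (fun a b => Im (g (a +i* b))) (Re z) (Im z).
Proof.
move=> gK; have /strictC_Re : strictC (fun w => - 'i * g w) z (- 'i * K).
  move=> e e0; have [d d0 gd] := gK e e0; exists d => // w w' wd wd'.
  have -> : - 'i * g w - - 'i * g w' - - 'i * K * (w - w') =
    - 'i * (g w - g w' - K * (w - w')) by ring.
  by rewrite normcM normcN normci mul1r; exact: gd.
congr strict_diff2; apply/funext => a; apply/funext => b.
by rewrite ReM /=; ring.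
Qed.

Lemma coord_dist_le p q n : `|co p n - co q n| <= `|p - q|.
Proof. by have := norm_coord_le ((p - q) : 'rV[R]_4) (inord n); rewrite !mxE. Qed.

Lemma holomorphic_strictC D F z k : open (D : set R[i]^o) ->
  holomorphic_on D F -> D z -> exists K, strictC (fun z => F z 0 k) z K.
Proof.
move=> oD FD Dz; have [r r0 rD] := open_contains_rect oD Dz.
exact: cdiff_on_strict r0 (cdiff_onS rD (holomorphic_cdiff k FD)).
Qed.

Lemma stem_Im_real D F k (a : R) : stem_function D F -> D (a +i* 0) ->
  Im (F (a +i* 0) 0 k) = 0.
Proof.
move=> FD Da; have /(congr1 (fun v : quat R => (v : 'rV[R]_4) 0 k)) :=
  stem_im0 FD Da (erefl : Im (a +i* 0) = 0).
by rewrite !mxE.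
Qed.

(** The components of F are real on the real axis, hence so are their
    difference quotients between real points. *)
Lemma stem_derivative_real D F k z K : open (D : set R[i]^o) ->
  stem_function D F -> D z -> Im z = 0 ->
  strictC (fun z => F z 0 k) z K -> Im K = 0.
Proof.
move=> oD FD Dz z0 FK; have [r r0 rD] := open_contains_rect oD Dz.
have zE : z = Re z +i* 0 by apply: complex_eq.
apply/eqP; rewrite -normr_le0; apply/ler_addgt0Pl => e e0; rewrite addr0.
have [d d0 Fd] := FK e e0; pose t := Num.min d r / 2.
have m0 : 0 < Num.min d r by rewrite lt_min d0.
have t0 : 0 < t by rewrite divr_gt0.
have [td tr] : t < d /\ t < r.
  have : t < Num.min d r by rewrite gtr_pMr// invf_lt1// ltr1n.
  by rewrite lt_min => /andP.
pose w := (Re z + t) +i* 0.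
have wz : w - z = t%:C.
  by apply: complex_eq; rewrite ?ReD ?ImD ?ReN ?ImN /= ?z0; ring.
have := Fd w z; rewrite wz normc_real subrr normc0 (gtr0_norm t0) => /(_ td d0).
have Dw : D w by apply: rD; split; apply/andP; split=> /=; lra.
move/(le_trans (ler_norm_Im _)); rewrite !ImD !ImN ImM /= mulr0 add0r.
rewrite (stem_Im_real k FD Dw) zE (stem_Im_real k FD) -?zE//.
by rewrite !subr0 sub0r normrN normrM (gtr0_norm t0) ler_pM2r.
Qed.

Lemma strict_diff1_coord_linear (a : R) i (g : 'rV[R]_4 -> R) q :
  (forall e : R, 0 < e -> exists2 d : R, 0 < d & forall x y,
    `|x - q| < d -> `|y - q| < d ->
    `|g x - g y - a * (x 0 i - y 0 i)| <= e * `|x - y|) -> strict_diff1 g q.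
Proof.
move=> gq; exists (a *: delta_mx i 0) => e /gq[d d0 gd]; exists d => // x y xq yq.
by have := gd x y xq yq; rewrite -scalemxAr -colE !mxE.
Qed.

Lemma strict_diff1_qradius q : 0 < qradius q -> strict_diff1 qradius q.
Proof.
move=> b0; have -> : qradius = (fun x => Num.sqrt
    (co x 1 * co x 1 + co x 2 * co x 2 + co x 3 * co x 3)).
  by apply/funext => x; rewrite /qradius !expr2.
apply: strict_diff1_sqrt; first by rewrite -!expr2 -sqrtr_gt0.
by do ![apply: strict_diff1D|apply: strict_diff1M]; exact: strict_diff1_coord.
Qed.

(** The radius is not differentiable at a real point, but there the derivative
    of the stem function is real, so the real part does not depend on the
    radius to first order. *)
Lemma strict_diff1_stem_Re D F k q : open (D : set R[i]^o) ->
  holomorphic_on D F -> stem_function D F -> D (qpoint q) ->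
  strict_diff1 (fun x => Re (F (qpoint x) 0 k)) q.
Proof.
move=> oD FD Fs Dq; have [K FK] := holomorphic_strictC k oD FD Dq.
have := qradius_ge0 q; rewrite le_eqVlt => /predU1P[b0|b0]; last first.
  apply: (strict_diff1_comp2 (strictC_Re FK)); first exact: strict_diff1_coord.
  exact: strict_diff1_qradius.
have K0 := stem_derivative_real oD Fs Dq (esym b0) FK.
apply: (@strict_diff1_coord_linear (Re K) (inord 0)) => e e0.
have e4 : 0 < e / 4 by rewrite divr_gt0.
have [d d0 Fd] := FK _ e4; exists (d / 4); first by rewrite divr_gt0.
have near x : `|x - q| < d / 4 -> normc (qpoint x - qpoint q) < d.
  by move=> xq; apply: le_lt_trans (qpoint_lipschitz x q) _; lra.
move=> x y /near xq /near yq; have := Fd _ _ xq yq.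
move/(le_trans (ler_norm_Re _)); rewrite !ReD !ReN ReM K0 mul0r subr0 ReD ReN /=.
move/le_trans; apply; have := ler_wpM2l (ltW e4) (qpoint_lipschitz x y).
by rewrite mulrA divfK.
Qed.

Lemma qdir_bound m q : (m \in [:: 1; 2; 3])%N ->
  `|co (qdir q) m| <= 1 /\ co (qdir q) m * qradius q = co q m.
Proof.
move=> m3; have [_ d1 d2 d3] := qdirE q.
have E : co (qdir q) m = (qradius q)^-1 * co q m.
  by move: m3; rewrite !inE => /or3P[]/eqP->.
have B : `|co q m| <= qradius q.
  by have [? ? ?] := ler_coord_qradius q; move: m3; rewrite !inE => /or3P[]/eqP->.
rewrite E; have [b0|b0] := eqVneq (qradius q) 0.
  rewrite b0 invr0 !mul0r normr0; split=> //.
  by move: B; rewrite b0 normr_le0 => /eqP.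
split; last by rewrite mulrAC mulVf// mul1r.
rewrite normrM normfV (ger0_norm (qradius_ge0 q)) mulrC ler_pdivrMr ?mul1r//.
by rewrite lt_def b0 qradius_ge0.
Qed.

(** At a real point write Im F = kap r + G, where r is the radius.  The m-th
    coordinate J of the direction satisfies J r = q_m, so J kap r is linear.
    For the remaining term, J x G x - J y G y is
    J x (G x - G y) + (J x - J y) G y, where |J| <= 1, G is e-Lipschitz,
    |G y| <= e r(y), and |J x - J y| r(y) is at most a multiple of |x - y|. *)
Lemma strict_diff1_stem_Im D F k m q : (m \in [:: 1; 2; 3])%N ->
  open (D : set R[i]^o) -> holomorphic_on D F -> stem_function D F ->
  D (qpoint q) ->
  strict_diff1 (fun x => co (qdir x) m * Im (F (qpoint x) 0 k)) q.
Proof.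
move=> m3 oD FD Fs Dq; have [K FK] := holomorphic_strictC k oD FD Dq.
have := qradius_ge0 q; rewrite le_eqVlt => /predU1P[b0|b0]; last first.
  apply: strict_diff1M; last first.
    apply: (strict_diff1_comp2 (strictC_Im FK)); first exact: strict_diff1_coord.
    exact: strict_diff1_qradius.
  have -> : (fun x => co (qdir x) m) = (fun x => (qradius x)^-1 * co x m).
    apply/funext => x; have [_ d1 d2 d3] := qdirE x.
    by move: m3; rewrite !inE => /or3P[]/eqP->.
  apply: strict_diff1M; last exact: strict_diff1_coord.
  by apply: strict_diff1V => //; exact: strict_diff1_qradius.
have K0 := stem_derivative_real oD Fs Dq (esym b0) FK.
have [r r0 rD] := open_contains_rect oD Dq.
set kap := Re K.
apply: (@strict_diff1_coord_linear kap (inord m)) => e e0.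
have e8 : 0 < e / 8 by rewrite divr_gt0.
have [d d0 Fd] := FK _ e8; exists (Num.min (d / 4) r).
  by rewrite lt_min divr_gt0.
have near x : `|x - q| < Num.min (d / 4) r ->
    [/\ normc (qpoint x - qpoint q) < d, normc ((co x 0 +i* 0) - qpoint q) < d &
        D (co x 0 +i* 0)].
  rewrite lt_min => /andP[xd xr]; have x0 := coord_dist_le x q 0.
  split; first by apply: le_lt_trans (qpoint_lipschitz x q) _; lra.
    apply: le_lt_trans (ler_normc_pair _ _ _ _) _.
    by rewrite -b0 subrr normr0; have := normr_ge0 (x - q); lra.
  apply: rD; move: x0; rewrite ler_norml => /andP[x1 x2].
  by split; apply/andP; split=> /=; rewrite -?b0; lra.
move=> x y /near[xq x'q Dx] /near[yq y'q Dy].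
pose G u := Im (F (qpoint u) 0 k) - kap * qradius u.
have Gxy : `|G x - G y| <= e / 8 * (4 * `|x - y|).
  have := Fd _ _ xq yq; move/(le_trans (ler_norm_Im _)).
  rewrite !ImD !ImN ImM K0 mul0r addr0 ImD ImN /= => H.
  have -> : G x - G y = Im (F (qpoint x) 0 k) - Im (F (qpoint y) 0 k) -
      Re K * (qradius x - qradius y) by rewrite /G /kap; ring.
  by apply: le_trans H _; rewrite ler_wpM2l ?(ltW e8)// qpoint_lipschitz.
have Gy : `|G y| <= e / 8 * qradius y.
  have := Fd _ _ yq y'q; move/(le_trans (ler_norm_Im _)).
  rewrite !ImD !ImN ImM K0 mul0r addr0 ImD ImN /= (stem_Im_real k Fs Dy) !subr0.
  rewrite -/(G y) => /le_trans; apply; rewrite ler_wpM2l ?(ltW e8)//.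
  by rewrite subrr expr0n add0r sqrtr_sqr ger0_norm ?qradius_ge0.
have [Jx1 JxE] := qdir_bound x m3; have [Jy1 JyE] := qdir_bound y m3.
set jx := co (qdir x) m in Jx1 JxE *; set jy := co (qdir y) m in Jy1 JyE *.
have xyr := qradius_lipschitz y x; have xym := coord_dist_le x y m.
rewrite distrC [`|y - x|]distrC in xyr.
have JJ : `|jx - jy| * qradius y <= 4 * `|x - y|.
  rewrite -[X in _ * X <= _](ger0_norm (qradius_ge0 y)) -normrM.
  have -> : (jx - jy) * qradius y = - jx * (qradius x - qradius y) + (co x m - co y m).
    by rewrite -JyE -JxE; ring.
  apply: le_trans (ler_normD _ _) _; rewrite normrM normrN.
  have := ler_pM (normr_ge0 _) (normr_ge0 _) Jx1 xyr; lra.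
have -> : jx * Im (F (qpoint x) 0 k) - jy * Im (F (qpoint y) 0 k) -
    kap * (co x m - co y m) = jx * (G x - G y) + (jx - jy) * G y.
  by rewrite -JxE -JyE /G; ring.
apply: le_trans (ler_normD _ _) _; rewrite !normrM.
have h1 := ler_pM (normr_ge0 _) (normr_ge0 _) Jx1 Gxy.
have h2 := ler_wpM2l (normr_ge0 (jx - jy)) Gy.
have h3 := ler_wpM2l (ltW e8) JJ.
have -> : e * `|x - y| = 1 * (e / 8 * (4 * `|x - y|)) + e / 8 * (4 * `|x - y|) by field.
by apply: lerD => //; apply: le_trans h2 _; rewrite mulrCA.
Qed.

Lemma slice_strict_diff D F (f : quat R -> quat R) q : open (D : set R[i]^o) ->
  (forall z, D z -> D (conjc z)) -> holomorphic_on D F -> stem_function D F ->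
  induces D F f -> slice_domain D q ->
  exists M, strict_diff (f : 'rV[R]_4 -> 'rV[R]_4) q M.
Proof.
move=> oD Dc FD Fs Ff Uq; have Dq := (slice_domainP q Dc).1 Uq.
pose A k x := Re (F (qpoint x) 0 (inord k)).
pose B m k x := co (qdir x) m * Im (F (qpoint x) 0 (inord k)).
have Aq k : strict_diff1 (A k) q by exact: (strict_diff1_stem_Re _ oD FD Fs Dq).
have Bq m k : (m \in [:: 1; 2; 3])%N -> strict_diff1 (B m k) q.
  by move=> m3; exact: (strict_diff1_stem_Im _ m3 oD FD Fs Dq).
pose g0 x := A 0 x - B 1 1 x - B 2 2 x - B 3 3 x.
pose g1 x := A 1 x + B 1 0 x + B 2 3 x - B 3 2 x.
pose g2 x := A 2 x - B 1 3 x + B 2 0 x + B 3 1 x.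
pose g3 x := A 3 x + B 1 2 x - B 2 1 x + B 3 0 x.
pose g (i : 'I_4) := nth g0 [:: g0; g1; g2; g3] i.
apply: (@strict_diff_of_coord _ _ _ g (slice_domain D)) => //.
- exact: open_slice_domain.
- move=> x i /(slice_domainP x Dc) Dx.
  rewrite (slice_functionE Fs Ff Dx); have [d0 _ _ _] := qdirE x.
  have [E0 E1 E2 E3] := pi_CH_coord (F (qpoint x)) d0.
  have reE n : co (cq_re (F (qpoint x))) n = A n x by rewrite mxE.
  have imE n : co (cq_im (F (qpoint x))) n = Im (F (qpoint x) 0 (inord n)).
    by rewrite mxE.
  rewrite !reE !imE in E0 E1 E2 E3.
  by move: i; apply: ord4P; rewrite /g inordK//=.
- by apply: ord4P; rewrite /g inordK//=;
    do ![apply: strict_diff1B|apply: strict_diff1D]; (exact: Aq || exact: Bq).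
Qed.

End SliceFunctions.

(** * Coverings from closed maps with finite fibres *)

Section LocalHomeomorphismCovering.
Variables X Y : topologicalType.
Implicit Types (A P : set X) (f : X -> Y).

Lemma open_finite_bigcap (Z : topologicalType) (I : choiceType) (P : set I)
    (F : I -> set Z) : finite_set P -> (forall i, P i -> open (F i)) ->
  open (\bigcap_(i in P) F i).
Proof.
move=> Pfin Fo; rewrite -[X in open X]setCK openC setC_bigcap.
by apply: closed_bigcup => // i /Fo; rewrite closedC.
Qed.

Lemma separate_finite P : hausdorff_space X -> finite_set P ->
  exists N : X -> set X, (forall p, P p -> open (N p) /\ N p p) /\
    (forall p q x, P p -> P q -> N p x -> N q x -> p = q).
Proof.
rewrite open_hausdorff => XH Pfin.
have sep (pq : X * X) : exists AB : set X * set X, pq.1 != pq.2 ->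
    [/\ AB.1 pq.1, AB.2 pq.2, open AB.1, open AB.2 & AB.1 `&` AB.2 = set0].
  have [_|/XH[AB [/set_mem p1 /set_mem p2] [o1 o2 /eqP d]]] := eqVneq pq.1 pq.2.
    by exists (setT, setT).
  by exists AB.
have [F FP] := choice sep.
exists (fun p => \bigcap_(q in [set q | P q /\ p != q])
  ((F (p, q)).1 `&` (F (q, p)).2)); split.
- move=> p Pp; split.
    apply: open_finite_bigcap; first by apply: sub_finite_set Pfin => q [].
    move=> q [Pq pq]; have [_ _ o1 _ _] := FP (p, q) pq.
    by rewrite eq_sym in pq; have [_ _ _ o2 _] := FP (q, p) pq; exact: openI.
  move=> q [Pq pq]; have [h1 _ _ _ _] := FP (p, q) pq; split=> //.
  by rewrite eq_sym in pq; have [_ h2 _ _ _] := FP (q, p) pq.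
- move=> p q x Pp Pq Np Nq; apply/eqP; apply: contrapT => /negP pq.
  have [h1 _] := Np q (conj Pq pq).
  have [_ h2] : ((F (q, p)).1 `&` (F (p, q)).2) x.
    by apply: Nq; split=> //; rewrite eq_sym.
  have [_ _ _ _ d] := FP (p, q) pq.
  by have : set0 x by rewrite -d.
Qed.

(** The inverse is continuous because f is open on A. *)
Lemma homeomorphism_on_open_injective A (V : set Y) f (x0 : X) :
  {within A, continuous f} -> {in A &, injective f} ->
  (forall O, open O -> open (f @` (A `&` O))) -> V `<=` f @` A ->
  homeomorphism_on (A `&` f @^-1` V) V f.
Proof.
move=> fC finj fo VA; split; first by move=> x [].
  by apply: continuous_subspaceW fC => x [].
pose g v := xget x0 [set x | A x /\ f x = v].
have gP v : V v -> A (g v) /\ f (g v) = v.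
  by move=> /VA[x Ax fx]; apply: (@xgetPex _ x0 [set x | A x /\ f x = v]); exists x.
have gf x : A x -> V (f x) -> g (f x) = x.
  by move=> Ax /gP[Ag fg]; apply: finj; rewrite ?inE.
exists g; split.
- by move=> v Vv; have [Ag fg] := gP v Vv; split; rewrite //= fg.
- apply/subspace_continuousP => v Vv N; rewrite nbhsE => -[O [oO Og] ON].
  have [Ag fg] := gP v Vv.
  have : nbhs v (f @` (A `&` O)).
    by apply: open_nbhs_nbhs; split; [exact: fo|exists (g v)].
  apply: filterS => _ [x [Ax Ox] <-] Vfx; apply: ON => /=.
  by rewrite /from_subspace gf.
- by move=> x [Ax Vx]; exact: gf.
- by move=> v /gP[].
Qed.

(** The sheets over y are cut out of disjoint neighbourhoods M q of the points
    q of the fibre.  Removing the closed image of the complement of their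
    union B ensures that nothing else lies over V. *)
Lemma covering_of_sheets U C f : hausdorff_space X -> C `<=` U ->
  finite_map U f ->
  (forall q, U q -> ~ C q -> exists W : set X,
     [/\ open W, W q, W `<=` U `\` C, {in W &, injective f} &
         forall O, open O -> open (f @` (W `&` O))]) ->
  let U' := U `\` (U `&` f @^-1` (f @` C)) in covering_map U' (f @` U') f.
Proof.
move=> XH CU [fC fcl ffin] sheet U'; split=> //.
  by apply: continuous_subspaceW fC => x [].
move=> y [x0 [Ux0 Sx0] fx0].
have yC : ~ (f @` C) y by move=> yC; apply: Sx0; split=> //=; rewrite fx0.
set P := U `&` f @^-1` [set y].
have Pfin : finite_set P := ffin y.
have Px0 : P x0 by [].
have [N [NP Nsep]] := separate_finite XH Pfin.
have /choice[W WP] (q : X) : exists W : set X, P q ->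
    [/\ open W, W q, W `<=` U `\` C, {in W &, injective f} &
         forall O, open O -> open (f @` (W `&` O))].
  have [[Uq fq]|] := EM (P q); last by exists set0.
  have [|W0 WP] := sheet q Uq; last by exists W0.
  by move=> Cq; apply: yC; exists q.
pose M q := W q `&` N q.
have Mo q : P q -> open (M q).
  by move=> Pq; have [Wo _ _ _ _] := WP q Pq; have [No _] := NP q Pq; exact: openI.
have Mq q : P q -> M q q.
  by move=> Pq; have [_ Wq _ _ _] := WP q Pq; have [_ Nq] := NP q Pq; split.
have MU q x : P q -> M q x -> U x /\ ~ C x.
  by move=> Pq [Wx _]; have [_ _ /(_ _ Wx)] := WP q Pq.
have Minj q : P q -> {in M q &, injective f}.
  move=> Pq u v /set_mem[Wu _] /set_mem[Wv _]; have [_ _ _ + _] := WP q Pq.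
  by apply; rewrite inE.
have Mf q O : P q -> open O -> open (f @` (M q `&` O)).
  move=> Pq oO; have [_ _ _ _ fo] := WP q Pq; have [No _] := NP q Pq.
  by rewrite /M -setIA; apply: fo; exact: openI.
pose B := \bigcup_(q in P) M q.
pose V := (\bigcap_(q in P) f @` M q) `\` f @` (U `\` B).
have Vo : open V.
  rewrite /V setDE; apply: openI.
    apply: open_finite_bigcap => // q Pq.
    by have := Mf q setT Pq openT; rewrite setIT.
  apply: closed_openC; apply: fcl; first by move=> x [].
  apply/closed_subspaceP; exists (~` B); last by rewrite setDE setIAC setIid setIC.
  by apply: open_closedC; apply: bigcup_open.
have Vy : V y.
  split; first by move=> q Pq; exists q; [exact: Mq|case: Pq].
  by move=> [x [Ux Bx] fx]; apply: Bx; exists x; [|exact: Mq].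
have VB x : U x -> V (f x) -> B x.
  by move=> Ux [_ Vx]; apply: contrapT => Bx; apply: Vx; exists x.
have U'V x : U x -> V (f x) -> U' x.
  move=> Ux Vx; split=> // -[_ [c Cc fcx]].
  have [q Pq Mc] : B c by apply: VB; [exact: CU|rewrite fcx].
  by have [] := MU q c Pq Mc.
exists V => //; split.
- move=> v Vv; have [x Mx fx] := Vv.1 x0 Px0; exists x => //.
  by apply: U'V; [have [] := MU x0 x Px0 Mx|rewrite fx].
- exact: open_subspaceW.
exists [set M q `&` f @^-1` V | q in P]; split.
- apply/seteqP; split=> x.
    move=> [[Ux _] Vx]; have [q Pq Mx] := VB x Ux Vx.
    by exists (M q `&` f @^-1` V); [exists q|].
  by move=> [_ [q Pq <-] [Mx Vx]]; split=> //; apply: U'V => //; have [] := MU q x Pq Mx.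
- move=> _ _ [p Pp <-] [q Pq <-] [x [[[_ Nx] _] [[_ Nx'] _]]] /=.
  by rewrite (Nsep p q x).
- move=> _ [q Pq <-]; apply: open_subspaceW.
  have /continuousP/(_ _ Vo)/open_subspaceP[V0 oV0 V0E] := fC.
  have -> : M q `&` f @^-1` V = M q `&` V0.
    apply/seteqP; split=> x [Mx Vx]; split=> //; have [Ux _] := MU q x Pq Mx.
      by have [] : (V0 `&` U) x by rewrite V0E.
    by have [] : (from_subspace U f @^-1` V `&` U) x by rewrite -V0E.
  by apply: openI => //; exact: Mo.
- move=> _ [q Pq <-]; apply: homeomorphism_on_open_injective => //.
  + by apply: continuous_subspaceW fC => x Mx; have [] := MU q x Pq Mx.
  + exact: Minj.
  + by move=> O; exact: Mf.
  + by move=> v [/(_ q Pq)].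
Qed.

End LocalHomeomorphismCovering.

(** * The covering theorem *)

Theorem theorem3p4 (R : realType) (D : set (complex R))
    (f : quat R -> quat R) (D_open : open (D : set (complex R)^o))
    (D_conj : [set conjc z | z in D] = D)
    (f_regular : slice_regular D f)
    (f_finite : finite_map (slice_domain D) f) :
  let U := slice_domain D in
  let U' := U `\` crit_fibres U f in
  f @` U' `<=` ~` crit_values U f /\ covering_map U' (f @` U') f.
Proof.
move=> U U'; split.
  by move=> _ [x [Ux Sx] <-] Cx; apply: Sx.
have [F [Fs Fhol Ff]] := f_regular.
have Dc z : D z -> D (conjc z) by move=> Dz; rewrite -D_conj; exists z.
apply: (covering_of_sheets (@norm_hausdorff _ _) _ f_finite) => [q []//|q Uq Cq].
apply: (@strict_diff_sheet R 4 f U q) => //.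
- exact: open_slice_domain.
- by move=> x Ux; exact: slice_strict_diff Fhol Fs Ff Ux.
- by apply: contrapT => bq; apply: Cq.
Qed.
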